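(* There exist regular constant distance, complete, convex, $C^{1,1}$ surfaces $K_0$ and $K_r$ in $\mathbb{R}^3$ with the property that, wherever the surfaces are $C^2$, their principal curvatures $a_1,a_2$ satisfy either (i) $a_1a_2=0$ or (ii) $a_1=a_2$, but the projection from $K_0$ to $K_r$ does not preserve geodesics.
   Context: A surface is $C^{1,1}$ if it is once continuously differentiable with Lipschitz first derivatives. A convex surface means the boundary of a convex body in $\mathbb{R}^3$ (not required to be bounded). For closed surfaces $S_1,S_2$ in $\mathbb{R}^3$, the projection $\Pi:S_1\to S_2$ sends $x\in S_1$ to the set of points $y\in S_2$ minimizing the Euclidean distance $d(x,y)$. Two surfaces $S_1,S_2$ are called regular constant distance surfaces if the Euclidean distance from any point $x\in S_1$ to $S_2$ equals a fixed number $r>0$, and the nearest point on $S_2$ is always unique. A geodesic of a $C^{1,1}$ surface is a curve in it that is locally length-minimizing; any non-singular reparametrization (i.e. with non-zero, possibly variable, speed) of a unit speed geodesic is also called a geodesic. A map between surfaces preserves geodesics if it sends every geodesic of the first surface to a (possibly reparametrized) geodesic of the second. *)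

(* Defs.v *)
From HB Require Import structures.
From mathcomp Require Import all_boot all_order all_algebra.
From mathcomp Require Import all_classical all_reals all_analysis.
Set Implicit Arguments.
Unset Strict Implicit.
Unset Printing Implicit Defensive.
Import Order.TTheory GRing.Theory Num.Theory.
Import numFieldNormedType.Exports.
Local Open Scope classical_set_scope.
Local Open Scope ring_scope.

(* The library norm `|_| on 'rV[R]_n is the sup norm.  It is used below only
   for topological notions and for Lipschitz conditions with an unspecified
   constant, which do not depend on the choice of the norm; every metric
   quantity (distance, length, normal, curvature) is Euclidean. *)

Definition dotv (R : realType) (n : nat) (u v : 'rV[R]_n) : R :=
  \sum_i u 0 i * v 0 i.

Definition edist (R : realType) (n : nat) (x y : 'rV[R]_n) : R :=
  Num.sqrt (dotv (x - y) (x - y)).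

Definition convex_body (R : realType) (B : set 'rV[R]_3) : Prop :=
  [/\ convex_set (B : set (convex_lmodType 'rV[R]_3)),
      closed B & interior B !=set0].

Definition convex_surface (R : realType) (S : set 'rV[R]_3) : Prop :=
  exists B : set 'rV[R]_3, convex_body B /\ S = closure B `\` interior B.

Definition partial (R : realType) (i : 'I_2) (f : 'rV[R]_2 -> 'rV[R]_3) :
  'rV[R]_2 -> 'rV[R]_3 := fun u => 'D_(delta_mx 0 i) f u.

Definition C1_on (R : realType) (V : set 'rV[R]_2)
    (f : 'rV[R]_2 -> 'rV[R]_3) : Prop :=
  forall i : 'I_2, (forall u, V u -> derivable f u (delta_mx 0 i)) /\
                   {within V, continuous (partial i f)}.

Definition C11_on (R : realType) (V : set 'rV[R]_2)
    (f : 'rV[R]_2 -> 'rV[R]_3) : Prop :=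
  C1_on V f /\ forall i : 'I_2, [lipschitz partial i f u | u in V].

Definition C2_on (R : realType) (V : set 'rV[R]_2)
    (f : 'rV[R]_2 -> 'rV[R]_3) : Prop :=
  C1_on V f /\ forall i : 'I_2, C1_on V (partial i f).

Definition tangent_frame (R : realType) (phi : 'rV[R]_2 -> 'rV[R]_3)
    (u : 'rV[R]_2) : 'M[R]_(2, 3) :=
  \matrix_(i < 2) partial i phi u.

(* phi is an immersion of V and a homeomorphism of V onto the relatively
   open piece S `&` U of S; injectivity is implied by the existence of psi. *)
Definition local_param (R : realType) (S U : set 'rV[R]_3)
    (V : set 'rV[R]_2) (phi : 'rV[R]_2 -> 'rV[R]_3) : Prop :=
  [/\ open U, open V, phi @` V = S `&` U,
      (exists psi : 'rV[R]_3 -> 'rV[R]_2,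
         {within S `&` U, continuous psi} /\
         forall u, V u -> psi (phi u) = u)
    & forall u, V u -> row_free (tangent_frame phi u)].

Definition C11_surface (R : realType) (S : set 'rV[R]_3) : Prop :=
  forall p, S p -> exists U V phi,
    [/\ U p, local_param S U V phi & C11_on V phi].

Definition C2_surface_at (R : realType) (S : set 'rV[R]_3) (p : 'rV[R]_3)
    : Prop :=
  exists U V phi, [/\ S p, U p, local_param S U V phi & C2_on V phi].

Definition first_form (R : realType) (phi : 'rV[R]_2 -> 'rV[R]_3)
    (u : 'rV[R]_2) : 'M[R]_2 :=
  \matrix_(i, j) dotv (partial i phi u) (partial j phi u).

Definition second_form (R : realType) (phi : 'rV[R]_2 -> 'rV[R]_3)
    (nu : 'rV[R]_3) (u : 'rV[R]_2) : 'M[R]_2 :=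
  \matrix_(i, j) dotv (partial i (partial j phi) u) nu.

(* Matrix of the shape operator (Weingarten map) in the basis given by the
   two tangent vectors. *)
Definition shape_operator (R : realType) (phi : 'rV[R]_2 -> 'rV[R]_3)
    (nu : 'rV[R]_3) (u : 'rV[R]_2) : 'M[R]_2 :=
  invmx (first_form phi u) *m second_form phi nu u.

Definition unit_normal (R : realType) (phi : 'rV[R]_2 -> 'rV[R]_3)
    (nu : 'rV[R]_3) (u : 'rV[R]_2) : Prop :=
  dotv nu nu = 1 /\ forall i : 'I_2, dotv (partial i phi u) nu = 0.

(* a1, a2 are the eigenvalues, with multiplicity, of the shape operator of S
   at p, for some choice of a C^2 local parametrization and of one of the two
   unit normals; reversing the normal changes the sign of both. *)
Definition principal_curvatures (R : realType) (S : set 'rV[R]_3)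
    (p : 'rV[R]_3) (a1 a2 : R) : Prop :=
  exists U V phi u nu,
    [/\ local_param S U V phi, C2_on V phi, V u /\ phi u = p,
        unit_normal phi nu u
      & char_poly (shape_operator phi nu u)
          = ('X - a1%:P) * ('X - a2%:P)].

Definition curve_length (R : realType) (a b : R) (c : R -> 'rV[R]_3) : \bar R :=
  ereal_sup [set (\sum_(0 <= k < size s)
                    edist (c (nth b (a :: s) k.+1)) (c (nth b (a :: s) k)))%:E
            | s in [set s | itv_partition a b s]].

Definition joins (R : realType) (S : set 'rV[R]_3) (a b : R)
    (c : R -> 'rV[R]_3) (x y : 'rV[R]_3) : Prop :=
  [/\ a <= b, {within `[a, b], continuous c},
      (forall t, a <= t <= b -> S (c t)), c a = x & c b = y].

Definition intrinsic_dist (R : realType) (S : set 'rV[R]_3) (x y : 'rV[R]_3)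
    : \bar R :=
  ereal_inf [set l | exists a b c, joins S a b c x y /\ l = curve_length a b c].

Definition complete_surface (R : realType) (S : set 'rV[R]_3) : Prop :=
  forall x : nat -> 'rV[R]_3, (forall n, S (x n)) ->
    (forall e : R, 0 < e -> exists N, forall m n, (N <= m)%N -> (N <= n)%N ->
       (intrinsic_dist S (x m) (x n) < e%:E)%E) ->
    exists2 y, S y & (fun n => intrinsic_dist S (x n) y) @ \oo --> 0%E.

Definition proper_interval (R : realType) (I : set R) : Prop :=
  is_interval I /\ exists s t, [/\ I s, I t & s < t].

Definition locally_minimizing (R : realType) (S : set 'rV[R]_3) (I : set R)
    (c : R -> 'rV[R]_3) : Prop :=
  forall t0, I t0 -> exists2 e : R, 0 < e &
    forall s t, I s -> I t -> s <= t -> `|s - t0| < e -> `|t - t0| < e ->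
    forall a b c', joins S a b c' (c s) (c t) ->
      (curve_length s t c <= curve_length a b c')%E.

Definition unit_speed_geodesic (R : realType) (S : set 'rV[R]_3) (I : set R)
    (c : R -> 'rV[R]_3) : Prop :=
  [/\ proper_interval I, (forall t, I t -> S (c t)),
      (forall s t, I s -> I t -> s <= t -> curve_length s t c = (t - s)%:E)
    & locally_minimizing S I c].

(* h is a total function on R, so that at an endpoint of I its two-sided
   derivative is that of a C^1 extension of its restriction to I. *)
Definition geodesic (R : realType) (S : set 'rV[R]_3) (I : set R)
    (c : R -> 'rV[R]_3) : Prop :=
  proper_interval I /\
  exists (J : set R) (sigma : R -> 'rV[R]_3) (h : R -> R),
    [/\ unit_speed_geodesic S J sigma,
        (forall t, I t -> derivable h t 1 /\ 'D_1 h t != 0),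
        {within I, continuous 'D_1 h},
        h @` I = J
      & forall t, I t -> c t = sigma (h t)].

(* The reparametrization here is only required to be a homeomorphism: the
   projection between C^{1,1} surfaces is merely Lipschitz, and the image of a
   geodesic may have a discontinuous speed although its trace is a geodesic. *)
Definition geodesic_up_to_reparam (R : realType) (S : set 'rV[R]_3)
    (I : set R) (c : R -> 'rV[R]_3) : Prop :=
  exists (J : set R) (sigma : R -> 'rV[R]_3) (h : R -> R),
    [/\ geodesic S J sigma, {within I, continuous h}, set_inj I h,
        h @` I = J & forall t, I t -> c t = sigma (h t)].

Definition preserves_geodesics (R : realType) (S1 S2 : set 'rV[R]_3)
    (F : 'rV[R]_3 -> 'rV[R]_3) : Prop :=
  forall I c, geodesic S1 I c -> geodesic_up_to_reparam S2 I (F \o c).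

Definition nearest (R : realType) (S : set 'rV[R]_3) (x : 'rV[R]_3)
    : set 'rV[R]_3 :=
  [set y | S y /\ forall z, S z -> edist x y <= edist x z].

Definition dist_to (R : realType) (S : set 'rV[R]_3) (x : 'rV[R]_3) : R :=
  inf [set edist x y | y in S].

Definition regular_constant_distance (R : realType) (r : R)
    (S1 S2 : set 'rV[R]_3) : Prop :=
  0 < r /\ forall x, S1 x ->
    dist_to S2 x = r /\ exists! y, nearest S2 x y.

(* Only meaningful at points whose nearest point on S2 exists and is unique. *)
Definition projection (R : realType) (S2 : set 'rV[R]_3) (x : 'rV[R]_3)
    : 'rV[R]_3 := get (nearest S2 x).

(* Main.v *)
Require Import Defs.
From HB Require Import structures.
From mathcomp Require Import all_boot all_order all_algebra.
From mathcomp Require Import ring lra.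
From mathcomp Require Import all_classical all_reals all_analysis.
Import Order.TTheory GRing.Theory Num.Theory.
Import numFieldNormedType.Exports.
Local Open Scope classical_set_scope.
Local Open Scope ring_scope.
Set Implicit Arguments.
Unset Strict Implicit.
Unset Printing Implicit Defensive.

(* For r > 0 let E_r ([edge_surface r]) be the boundary of the
   r-neighbourhood of the wedge x, y <= 0, i.e. the surface (x^+)^2 + (y^+)^2
   = r^2: two half-planes joined by a quarter of a circular cylinder of radius
   r. It is a generalized cylinder, hence flat, so a1 a2 = 0 wherever it is
   C^2, and its arc length parametrization develops it isometrically onto the
   plane with coordinates (s, z). The projection from E_1 to E_2 is (s, z) |->
   (s, z) on the half-plane s <= 0 but (s, z) |-> (2 s, z) on the cylindrical
   part, so a straight line of the development which crosses s = 0 obliquely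
   is mapped to a broken line. A broken line can be shortcut near its corner,
   hence is not a geodesic. *)

(** * Euclidean norm *)

(** Lengths here are suprema of polygonal sums over merely continuous curves, so the isometry with
    the plane cannot be obtained by integrating a speed. It is proved on chords: [wrap] never
    increases a distance, and it shrinks a chord by a factor 1 - e at worst when the abscissas of
    its ends in the development differ by at most e r. Refining partitions and letting e tend to 0
    identifies the intrinsic distance with the planar one. The curvature claim quantifies over all
    C^2 local parametrizations, while [wrap] itself is only C^{1,1}. The degeneracy of the second
    fundamental form is therefore derived from the surface as a set: it has supporting half-spaces,
    and their normals are constant along the rulings. Finally, the image of a geodesic may be
    reparametrized by any homeomorphism, so the contradiction may only use the order of three points
    on the trace and the equality case of the triangle inequality in the development. *)

Local Notation edist := Defs.edist.

Section EuclideanNorm.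
Context {R : realType} {n : nat}.
Implicit Types (u v w : 'rV[R]_n) (a : R).

Definition enorm u : R := Num.sqrt (dotv u u).

Lemma dotvC u v : dotv u v = dotv v u.
Proof. by apply: eq_bigr => i _; rewrite mulrC. Qed.

Lemma dotvDl u v w : dotv (u + v) w = dotv u w + dotv v w.
Proof. by rewrite /dotv -big_split; apply: eq_bigr => i _; rewrite mxE mulrDl. Qed.

Lemma dotvZl a u v : dotv (a *: u) v = a * dotv u v.
Proof. by rewrite /dotv mulr_sumr; apply: eq_bigr => i _; rewrite mxE mulrA. Qed.

Lemma dotvNl u v : dotv (- u) v = - dotv u v.
Proof. by rewrite -scaleN1r dotvZl mulN1r. Qed.

Lemma dotvBl u v w : dotv (u - v) w = dotv u w - dotv v w.
Proof. by rewrite dotvDl dotvNl. Qed.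

Lemma dotvDr u v w : dotv u (v + w) = dotv u v + dotv u w.
Proof. by rewrite dotvC dotvDl !(dotvC u). Qed.

Lemma dotvZr a u v : dotv u (a *: v) = a * dotv u v.
Proof. by rewrite dotvC dotvZl dotvC. Qed.

Lemma dotvBr u v w : dotv u (v - w) = dotv u v - dotv u w.
Proof. by rewrite dotvC dotvBl !(dotvC u). Qed.

Lemma dotvv_ge0 u : 0 <= dotv u u.
Proof. by apply: sumr_ge0 => i _; rewrite -expr2 sqr_ge0. Qed.

Lemma dotvv_eq0 u : dotv u u = 0 -> u = 0.
Proof.
move=> /eqP; rewrite psumr_eq0 => [/allP u0|i _]; last by rewrite -expr2 sqr_ge0.
apply/rowP => i; rewrite mxE.
by have := u0 i (mem_index_enum _); rewrite /= mulf_eq0 orbb => /eqP.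
Qed.

Lemma enorm_ge0 u : 0 <= enorm u.
Proof. exact: sqrtr_ge0. Qed.

Lemma sqr_enorm u : enorm u ^+ 2 = dotv u u.
Proof. by rewrite sqr_sqrtr ?dotvv_ge0. Qed.

Lemma enorm_eq0 u : enorm u = 0 -> u = 0.
Proof. by move=> u0; apply: dotvv_eq0; rewrite -sqr_enorm u0 expr0n. Qed.

Lemma enormZ a u : enorm (a *: u) = `|a| * enorm u.
Proof.
by rewrite /enorm dotvZl dotvZr mulrA -expr2 sqrtrM ?sqr_ge0// sqrtr_sqr.
Qed.

Lemma dotv_le u v : dotv u v <= enorm u * enorm v.
Proof.
have [/enorm_eq0 ->|u0] := eqVneq (enorm u) 0.
  by rewrite -(scale0r (0 : 'rV[R]_n)) dotvZl mul0r enormZ normr0 !mul0r.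
have [/enorm_eq0 ->|v0] := eqVneq (enorm v) 0.
  by rewrite -(scale0r (0 : 'rV[R]_n)) dotvZr mul0r enormZ normr0 mul0r mulr0.
have uv0 : 0 < enorm u * enorm v.
  by rewrite mulr_gt0// lt_neqAle enorm_ge0 eq_sym ?u0 ?v0.
(* This square expands to 2 |u| |v| (|u| |v| - u.v). *)
have := dotvv_ge0 (enorm v *: u - enorm u *: v).
rewrite dotvBl !dotvBr !dotvZl !dotvZr (dotvC v u) -!sqr_enorm => h.
by rewrite -subr_ge0 -(pmulr_rge0 _ uv0); lra.
Qed.

Lemma enormD u v : enorm (u + v) <= enorm u + enorm v.
Proof.
rewrite -(@ler_pXn2r _ 2)// ?nnegrE ?addr_ge0 ?enorm_ge0//.
rewrite sqr_enorm dotvDl !dotvDr -!sqr_enorm (dotvC v u).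
by have := dotv_le u v; lra.
Qed.

Lemma edistC u v : edist u v = edist v u.
Proof. by rewrite /edist -opprB dotvNl dotvC dotvNl opprK. Qed.

Lemma edist_ge0 u v : 0 <= edist u v.
Proof. exact: enorm_ge0. Qed.

Lemma edist_triangle w u v : edist u v <= edist u w + edist w v.
Proof. by have := enormD (u - w) (w - v); rewrite addrA subrK. Qed.

Lemma edist_xx u : edist u u = 0.
Proof. by rewrite /edist subrr -(scale0r (0 : 'rV[R]_n)) dotvZl mul0r sqrtr0. Qed.

End EuclideanNorm.

Section Coordinates.
Context {R : realType}.

Definition rv2 (s z : R) : 'rV[R]_2 := \row_i nth 0 [:: s; z] i.
Definition rv3 (x y z : R) : 'rV[R]_3 := \row_i nth 0 [:: x; y; z] i.

Lemma rv2K (u : 'rV[R]_2) : rv2 (u 0 0) (u 0 1) = u.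
Proof.
by apply/rowP => i; rewrite mxE; case: i => [[|[|//]]] i /=; congr (u 0 _);
  apply: val_inj.
Qed.

Lemma rv3K (q : 'rV[R]_3) : rv3 (q 0 0) (q 0 1) (q 0 2%:R) = q.
Proof.
by apply/rowP => i; rewrite mxE; case: i => [[|[|[|//]]]] i /=; congr (q 0 _);
  apply: val_inj.
Qed.

Lemma dotv2 (u v : 'rV[R]_2) : dotv u v = u 0 0 * v 0 0 + u 0 1 * v 0 1.
Proof.
rewrite /dotv !big_ord_recl big_ord0 addr0.
by congr (_ + _); congr (u 0 _ * v 0 _); apply: val_inj.
Qed.

Lemma dotv3 (u v : 'rV[R]_3) :
  dotv u v = u 0 0 * v 0 0 + u 0 1 * v 0 1 + u 0 2%:R * v 0 2%:R.
Proof.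
rewrite /dotv !big_ord_recl big_ord0 addr0 addrA.
by congr (_ + _ + _); congr (u 0 _ * v 0 _); apply: val_inj.
Qed.

End Coordinates.

(** * The profile curve *)

(** Each difference quotient of [f] at [x] is one of [g] or of [h], and both tend to [d]. The branch
    may change from point to point, so one statement serves both the junctions and, with g = h, the
    smooth pieces. *)
Lemma is_derive_glue {R : realType} (f g h : R -> R) (x d : R) :
    is_derive x 1 g d -> is_derive x 1 h d -> f x = g x -> f x = h x ->
    (\forall y \near x, f y = g y \/ f y = h y) ->
  is_derive x 1 f d.
Proof.
move=> [gd gE] [hd hE] fg fh fgh.
have key : t^-1 *: ((f \o shift x) (t *: (1 : R)) - f x) @[t --> 0^'] --> d.
  have gc : t^-1 *: ((g \o shift x) (t *: (1 : R)) - g x) @[t --> 0^'] --> d.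
    by rewrite -gE; exact: gd.
  have hc : t^-1 *: ((h \o shift x) (t *: (1 : R)) - h x) @[t --> 0^'] --> d.
    by rewrite -hE; exact: hd.
  move=> A dA; have {}gA := gc A dA; have {}hA := hc A dA.
  have near_x : \forall t \near (0 : R)^', f (t *: 1 + x) = g (t *: 1 + x) \/
                                          f (t *: 1 + x) = h (t *: 1 + x).
    apply: cvg_within; move: fgh => /nbhs_ballP[e /= e0 fgh].
    apply/nbhs_ballP; exists e => // t; rewrite /ball /= sub0r normrN => te.
    by apply: fgh; rewrite /ball /= opprD addrCA subrr addr0 normrN /GRing.scale /= mulr1.
  apply: filterS3 near_x gA hA => t /=; rewrite -fg -fh.
  by case=> ->.
by split; [apply/cvg_ex; exists d|exact: cvg_lim key].
Qed.

Section Profile.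
Context {R : realType}.
Implicit Types x y : R.

(** The angle by which the profile curve has turned at arc length [x]: constant on the straight
    pieces, 1-Lipschitz but not differentiable at 0 and pi / 2, which is why the surface is C^{1,1}
    only. *)
Definition clamp x : R := Num.max 0 (Num.min x (pi / 2)).

(* [(profile s, profile (pi / 2 - s))] is the arc length parametrization of
   [x^+ ^ 2 + y^+ ^ 2 = 1]. *)
Definition profile x : R := Num.min x 0 + sin (clamp x).
Definition dprofile x : R := cos (clamp x).

Lemma pihalf_gt0 : 0 < pi / 2 :> R.
Proof. by rewrite divr_gt0 ?pi_gt0. Qed.

Lemma clamp_lt0 x : x <= 0 -> clamp x = 0.
Proof. by move=> x0; rewrite /clamp; apply/max_idPl; rewrite ge_min x0. Qed.

Lemma clamp_id x : 0 <= x -> x <= pi / 2 -> clamp x = x.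
Proof. by move=> x0 x1; rewrite /clamp; rewrite (min_idPl x1); apply/max_idPr. Qed.

Lemma clamp_gt x : pi / 2 <= x -> clamp x = pi / 2.
Proof.
by move=> x1; rewrite /clamp (min_idPr x1); apply/max_idPr; exact: ltW pihalf_gt0.
Qed.

Lemma clamp_refl x : clamp (pi / 2 - x) = pi / 2 - clamp x.
Proof.
have p0 := pihalf_gt0; have [x0|x0] := leP x 0.
  by rewrite (clamp_lt0 x0) clamp_gt; lra.
have [x1|x1] := leP x (pi / 2).
  by rewrite (clamp_id (ltW x0) x1) clamp_id; lra.
by rewrite (clamp_gt (ltW x1)) clamp_lt0; lra.
Qed.

Lemma clamp_lip x y : `|clamp x - clamp y| <= `|x - y|.
Proof.
have p0 := pihalf_gt0.
by rewrite /clamp !maxEle !minEle; do 4 case: ifPn; rewrite -?ltNge => *;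
  rewrite ler_norml; apply/andP; split; case: (ger0P (x - y)) => *; lra.
Qed.

Lemma profile_lt0 x : x <= 0 -> profile x = x.
Proof. by move=> x0; rewrite /profile clamp_lt0// sin0 addr0 (min_idPl x0). Qed.

Lemma profile_sin x : 0 <= x -> x <= pi / 2 -> profile x = sin x.
Proof. by move=> x0 x1; rewrite /profile clamp_id// (min_idPr x0) add0r. Qed.

Lemma profile_gt x : pi / 2 <= x -> profile x = 1.
Proof.
move=> x1; rewrite /profile clamp_gt// sin_pihalf (min_idPr _) ?add0r//.
by rewrite (le_trans _ x1)// ltW// pihalf_gt0.
Qed.

(** The branches x, sin x and 1 meet with common slope 1 at 0 and common slope 0 at pi / 2. *)
Lemma is_derive_profile x : is_derive x 1 profile (dprofile x).
Proof.
have p0 := pihalf_gt0; rewrite /dprofile.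
have [x0|x0|x0] := ltgtP x 0.
- rewrite clamp_lt0 ?cos0; last exact: ltW.
  apply: (@is_derive_glue _ _ id id); rewrite ?profile_lt0 ?ltW//.
  near=> y; left; rewrite profile_lt0// ltW//.
  by near: y; exact: lt_nbhsl.
- have [x1|x1|x1] := ltgtP x (pi / 2).
  + rewrite clamp_id ?(ltW x0) ?(ltW x1)//.
    apply: (@is_derive_glue _ _ sin sin); rewrite ?profile_sin ?ltW//.
    near=> y; left; rewrite profile_sin// ltW//.
      by near: y; exact: lt_nbhsr.
    by near: y; exact: lt_nbhsl.
  + rewrite clamp_gt ?cos_pihalf ?(ltW x1)//.
    apply: (@is_derive_glue _ _ (cst 1) (cst 1)); rewrite ?profile_gt ?ltW//.
    near=> y; left; rewrite profile_gt// ltW//.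
    by near: y; exact: lt_nbhsr.
  + rewrite x1 clamp_gt//.
    apply: (@is_derive_glue _ _ sin (cst 1)).
    * by rewrite cos_pihalf; exact: is_derive_cst.
    * by rewrite profile_gt ?sin_pihalf.
    * by rewrite profile_gt.
    * near=> y; have [y1|y1] := leP y (pi / 2); [left|right].
        rewrite profile_sin// ltW//.
        by near: y; exact: lt_nbhsr.
      by rewrite profile_gt ?ltW.
- rewrite x0 clamp_lt0// cos0.
  apply: (@is_derive_glue _ _ id sin).
  + by rewrite -[X in is_derive _ _ _ X]cos0; exact: is_derive_sin.
  + by rewrite profile_lt0.
  + by rewrite profile_lt0// sin0.
  + near=> y; have [y1|y1] := leP y 0; [left|right].
      by rewrite profile_lt0.
    rewrite profile_sin ?(ltW y1)// ltW//.
    by near: y; exact: lt_nbhsl.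
Unshelve. all: by end_near. Qed.

Lemma sin_refl x : sin (pi / 2 - x) = cos x.
Proof. by rewrite -opprB sinN sinBpihalf opprK. Qed.

Lemma cos_refl x : cos (pi / 2 - x) = sin x.
Proof. by rewrite -opprB cosN cosBpihalf. Qed.

Lemma dprofile_refl x : dprofile (pi / 2 - x) = sin (clamp x).
Proof. by rewrite /dprofile clamp_refl cos_refl. Qed.

(** The profile curve has unit speed; every isometry property of [wrap] rests on this. *)
Lemma dprofile_unit x : dprofile x ^+ 2 + dprofile (pi / 2 - x) ^+ 2 = 1.
Proof. by rewrite dprofile_refl cos2Dsin2. Qed.

Lemma cos_lip x y : `|cos x - cos y| <= `|x - y|.
Proof.
wlog xy : x y / x <= y.
  by move=> h; have [/h//|/ltW/h] := leP x y; rewrite distrC (distrC y).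
move: xy; rewrite le_eqVlt => /predU1P[->|xy]; first by rewrite !subrr normr0.
have [] := @MVT _ (@cos R) (fun z => - sin z) _ _ xy.
  by apply: continuous_subspaceT => z; exact: continuous_cos.
move=> z _ E; rewrite (distrC (cos x)) (distrC x) E normrM ler_piMl//.
by rewrite normrN ler_norml sin_geN1 sin_le1.
Qed.

Lemma dprofile_lip x y : `|dprofile x - dprofile y| <= `|x - y|.
Proof. exact: le_trans (cos_lip _ _) (clamp_lip _ _). Qed.

Lemma profile_curve x :
  Num.max (profile x) 0 ^+ 2 + Num.max (profile (pi / 2 - x)) 0 ^+ 2 = 1.
Proof.
have p0 := pihalf_gt0; have [x0|x0] := leP x 0.
  rewrite profile_lt0// profile_gt ?lerDl ?oppr_ge0// (max_idPr x0) maxEle.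
  by rewrite ler10 expr1n expr0n add0r.
have [x1|x1] := leP x (pi / 2).
  rewrite !profile_sin ?(ltW x0)//; [|lra..].
  rewrite sin_refl !max_l ?sin2cos2 ?subrK//.
    by rewrite cos_ge0_pihalf// x1 andbT; lra.
  by rewrite -cos_refl cos_ge0_pihalf//; apply/andP; split; lra.
have y0 : pi / 2 - x <= 0 by lra.
rewrite profile_gt ?(ltW x1)// (profile_lt0 y0) (max_idPr y0) (max_idPl ler01).
by rewrite expr1n expr0n addr0.
Qed.

Lemma atan_half x : 0 <= x -> x <= pi / 2 -> atan (sin x / (1 + cos x)) = x / 2.
Proof.
move=> x0 x1; have c0 : cos (x / 2) != 0.
  by rewrite gt_eqF// cos_gt0_pihalf//; apply/andP; split; have := pihalf_gt0; lra.
have -> : sin x / (1 + cos x) = tan (x / 2).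
  have sE : sin x = 2 * (sin (x / 2) * cos (x / 2)).
    by rewrite {1}(splitr x) sinD; ring.
  have cE : 1 + cos x = 2 * cos (x / 2) ^+ 2.
    by rewrite {1}(splitr x) cosD; have := cos2Dsin2 (x / 2); lra.
  by rewrite sE cE /tan; field.
by rewrite tanK// in_itv /=; apply/andP; split; have := pihalf_gt0; lra.
Qed.

End Profile.

(** * Length of curves *)

Section RealInduction.
Context {R : realType}.

(** Let t be the supremum of the points where [P] holds. The step at t carries [P] from some such
    point just below t either to [b] or to t + e / 2, and the latter contradicts the choice of t. It
    replaces compactness in the construction of fine partitions. *)
Lemma real_induction (a b : R) (P : R -> Prop) : a <= b -> P a ->
    (forall t, a <= t <= b -> exists2 e : R, 0 < e & forall x y,
       a <= x -> x <= y -> y <= b -> `|x - t| < e -> `|y - t| < e ->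
       P x -> P y) ->
  P b.
Proof.
move=> ab Pa step; pose A := [set t | a <= t <= b /\ P t].
have A0 : A a by split=> //; rewrite lexx.
have Aub : has_sup A by split; [exists a|exists b => t [/andP[_ ]]].
have tI : a <= sup A <= b.
  rewrite ub_le_sup//=; last by case: Aub.
  by apply: ge_sup; [exists a|move=> t [/andP[]]].
have [e e0 He] := step _ tI.
have [x [/andP[ax xb] Px] xe] := sup_adherent e0 Aub.
have xt : x <= sup A by apply: ub_le_sup; [case: Aub|split=> //; rewrite ax].
have {}xe : `|x - sup A| < e by rewrite ltr_norml; apply/andP; split; lra.
case/andP: tI => at_ tb.
have [yb|yb] := leP b (sup A + e / 2).
  apply: (He x b) => //.
  by rewrite ltr_norml; apply/andP; split; lra.
have Ay : A (sup A + e / 2).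
  split; first by apply/andP; split; lra.
  by apply: (He x) => //; [lra|exact: ltW|rewrite addrAC subrr add0r ger0_norm; lra].
have : sup A + e / 2 <= sup A by apply: ub_le_sup; [case: Aub|].
by lra.
Qed.

End RealInduction.

Section PolygonalLength.
Context {R : realType}.
Implicit Types (c : R -> 'rV[R]_3) (s : seq R).

Fixpoint polylength c (a : R) s : R :=
  if s is x :: s' then edist (c x) (c a) + polylength c x s' else 0.

Lemma polylengthE c (b a : R) s :
  \sum_(0 <= k < size s)
    edist (c (nth b (a :: s) k.+1)) (c (nth b (a :: s) k)) = polylength c a s.
Proof.
elim: s a => [|x s IH] a; first by rewrite big_geq.
by rewrite big_nat_recl//= -IH.
Qed.

Lemma polylength_rcons c (a y : R) s :
  polylength c a (rcons s y) = polylength c a s + edist (c y) (c (last a s)).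
Proof.
by elim: s a => [|x s IH] a /=; rewrite ?addr0 ?add0r// IH addrA.
Qed.

Lemma polylength_le_curve_length c (a b : R) s :
  itv_partition a b s -> ((polylength c a s)%:E <= curve_length a b c)%E.
Proof.
by move=> sab; apply: ereal_sup_ubound; exists s => //; rewrite polylengthE.
Qed.

Lemma curve_length_le c (a b : R) (l : \bar R) :
    (forall s, itv_partition a b s -> ((polylength c a s)%:E <= l)%E) ->
  (curve_length a b c <= l)%E.
Proof. by move=> h; apply: ge_ereal_sup => _ [s sab <-]; rewrite polylengthE h. Qed.

Lemma itv_partition_rcons (a x y : R) s :
  itv_partition a x s -> x < y -> itv_partition a y (rcons s y).
Proof.
move=> [ps /eqP ls] xy; split; last by rewrite last_rcons.
by rewrite rcons_path ps ls.
Qed.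

Lemma edist_le_curve_length c (a b : R) :
  a <= b -> ((edist (c b) (c a))%:E <= curve_length a b c)%E.
Proof.
rewrite le_eqVlt => /predU1P[->|ab].
  by rewrite edist_xx; apply: (@polylength_le_curve_length c b b [::]); split => /=.
have := @polylength_le_curve_length c a b [:: b]; rewrite /= addr0; apply.
exact: itv_partition1.
Qed.

Lemma lipschitz_curve_length c (k a b : R) : 0 <= k -> a <= b ->
    (forall x y, a <= x -> x <= y -> y <= b ->
       edist (c y) (c x) <= k * (y - x)) ->
  (curve_length a b c <= (k * (b - a))%:E)%E.
Proof.
move=> k0 ab cl; apply: curve_length_le => s; rewrite lee_fin => sab.
elim: s a ab cl sab => [|x s IH] a ab cl sab /=.
  by rewrite mulr_ge0// subr_ge0.
have ax : a < x by case: sab => /= /andP[].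
have xbs := itv_partition_cons sab; have xb := itv_partition_le xbs.
have h2 : polylength c x s <= k * (b - x).
  apply: IH => // y z xy yz zb; apply: cl => //.
  exact: le_trans (ltW ax) xy.
by have := cl a x (lexx _) (ltW ax) xb; lra.
Qed.

End PolygonalLength.

(** * The surfaces and their development *)

Section RoundedEdge.
Context {R : realType} (r : R).
Hypothesis r0 : 0 < r.
Implicit Types (s t : R) (u v : 'rV[R]_2) (p q : 'rV[R]_3).

Definition pos (x : R) : R := Num.max x 0.

Lemma pos_ge0 (x : R) : 0 <= pos x.
Proof. by rewrite le_max lexx orbT. Qed.

Lemma pos_id (x : R) : 0 <= x -> pos x = x.
Proof. by move=> /max_idPl. Qed.

Lemma pos_eq0 (x : R) : x <= 0 -> pos x = 0.
Proof. by move=> /max_idPr. Qed.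

Lemma posM (a x : R) : 0 <= a -> pos (a * x) = a * pos x.
Proof. by move=> a0; rewrite /pos maxr_pMr// mulr0. Qed.

Definition edge_surface : set 'rV[R]_3 :=
  [set q | pos (q 0 0) ^+ 2 + pos (q 0 1) ^+ 2 = r ^+ 2].

Definition abscissa s : R := r * profile (s / r).
Definition ordinate s : R := r * profile (pi / 2 - s / r).

Definition wrap u : 'rV[R]_3 :=
  rv3 (abscissa (u 0 0)) (ordinate (u 0 0)) (u 0 1).

(** On the half-planes the minima record the arc length. On the arc, 2 atan (sin / (1 + cos)) is the
    angle; it stays at atan 0 = 0 on the first half-plane and at 2 atan 1 = pi / 2 on the second,
    which supplies the offset r pi / 2. The denominator is at least r, so the formula is continuous
    on the whole space. *)
Definition unwrap q : 'rV[R]_2 :=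
  rv2 (Num.min (q 0 0) 0 - Num.min (q 0 1) 0
       + 2 * r * atan (pos (q 0 0) / (r + pos (q 0 1)))) (q 0 2%:R).

Lemma wrap_surface u : edge_surface (wrap u).
Proof.
rewrite /edge_surface /= !mxE /= /abscissa /ordinate !posM ?(ltW r0)//.
by rewrite !exprMn -mulrDr profile_curve mulr1.
Qed.

Lemma abscissa_le0 s : s <= 0 -> abscissa s = s.
Proof.
move=> s0; rewrite /abscissa profile_lt0 1?mulrC ?divfK ?gt_eqF//.
by rewrite mulr_ge0_le0// invr_ge0 ltW.
Qed.

Lemma abscissa_ge s : r * (pi / 2) <= s -> abscissa s = r.
Proof. by move=> s0; rewrite /abscissa profile_gt ?mulr1// ler_pdivlMr// mulrC. Qed.

Lemma abscissa_sin s : 0 <= s -> s <= r * (pi / 2) -> abscissa s = r * sin (s / r).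
Proof.
by move=> s0 s1; rewrite /abscissa profile_sin// ?divr_ge0 ?(ltW r0)// ler_pdivrMr// mulrC.
Qed.

Lemma ordinateE s : ordinate s = abscissa (r * (pi / 2) - s).
Proof.
rewrite /ordinate /abscissa; congr (_ * profile _).
by rewrite mulrBl mulrAC divff ?gt_eqF// mul1r.
Qed.

Lemma unwrapK : cancel wrap unwrap.
Proof.
move=> u; rewrite -[RHS]rv2K /unwrap !mxE /=.
move: (u 0 0) (u 0 1) => s z; have rp0 : 0 < r * (pi / 2) by rewrite mulr_gt0 ?pihalf_gt0.
congr rv2; have [s0|s0] := leP s 0.
  rewrite (abscissa_le0 s0) ordinateE abscissa_ge ?(min_idPl s0) ?(min_idPr (ltW r0)); last by lra.
  by rewrite (pos_eq0 s0) mul0r atan0 mulr0 subr0 addr0.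
have [s1|s1] := leP s (r * (pi / 2)).
  have t0 : 0 <= s / r by rewrite divr_ge0 // ltW.
  have t1 : s / r <= pi / 2 by rewrite ler_pdivrMr// mulrC.
  have sn : 0 <= sin (s / r).
    by rewrite -cos_refl cos_ge0_pihalf//; apply/andP; split; lra.
  have cs : 0 <= cos (s / r).
    by rewrite cos_ge0_pihalf//; apply/andP; split; lra.
  rewrite (abscissa_sin (ltW s0))// /ordinate profile_sin; [|lra..].
  rewrite sin_refl !min_r ?mulr_ge0 ?(ltW r0)//.
  rewrite !pos_id ?mulr_ge0 ?(ltW r0)// subr0 add0r.
  have -> : r * sin (s / r) / (r + r * cos (s / r)) = sin (s / r) / (1 + cos (s / r)).
    by rewrite -[X in _ / (X + _)]mulr1 -mulrDr -mulf_div divff ?mul1r// gt_eqF.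
  rewrite atan_half//.
  by field; rewrite gt_eqF.
have s2 : r * (pi / 2) - s <= 0 by lra.
rewrite (abscissa_ge (ltW s1)) ordinateE (abscissa_le0 s2).
rewrite (min_idPr (ltW r0)) (min_idPl s2) (pos_eq0 s2) (pos_id (ltW r0)).
rewrite addr0 divff ?gt_eqF// atan1; lra.
Qed.

Lemma wrap_surj q : edge_surface q -> exists u, wrap u = q.
Proof.
rewrite /edge_surface /= => E; rewrite -[q]rv3K; move: E.
move: (q 0 0) (q 0 1) (q 0 2%:R) => x y z E.
have posr w : pos w ^+ 2 = r ^+ 2 -> w = r.
  have [w0|w0] := leP w 0; first by rewrite pos_eq0// => /esym/eqP; rewrite expr0n sqrf_eq0 gt_eqF.
  by rewrite pos_id ?ltW// => /eqP; rewrite eqrXn2// ?ltW// => /eqP.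
suff [s xs ys] : exists2 s, abscissa s = x & ordinate s = y.
  by exists (rv2 s z); rewrite /wrap !mxE /= xs ys.
have [x0|x0] := leP x 0.
  exists x; first by rewrite abscissa_le0.
  rewrite ordinateE abscissa_ge; last by lra.
  by apply/esym/posr; rewrite -E (pos_eq0 x0) expr0n add0r.
have [y0|y0] := leP y 0.
  exists (r * (pi / 2) - y); last by rewrite ordinateE abscissa_le0; lra.
  rewrite abscissa_ge; last by lra.
  by apply/esym/posr; rewrite -E (pos_eq0 y0) expr0n addr0.
rewrite !pos_id ?ltW// in E.
have yr : y / r <= 1.
  rewrite ler_pdivrMr// mul1r -(@ler_pXn2r _ 2) ?nnegrE ?(ltW y0) ?(ltW r0)// -E.
  by rewrite lerDr sqr_ge0.
have yrI : -1 <= y / r <= 1 by rewrite yr (le_trans (lerN10 _))// divr_ge0 ?(ltW y0) ?(ltW r0).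
(* On the arc [ordinate s] is r cos (s / r), so the parameter is r times this angle; y > 0 keeps the
   angle below pi / 2. *)
have a0 : 0 <= acos (y / r) by exact: acos_ge0.
have a1 : acos (y / r) <= pi / 2.
  rewrite leNgt; apply/negP => a1; have : 0 < cos (acos (y / r)).
    by rewrite acosK ?divr_gt0// in_itv.
  rewrite -(subrK pi (acos _)) cosDpi oppr_gt0 ltNge cos_ge0_pihalf//.
  by have := acos_lepi yrI; have := pihalf_gt0; move=> *; apply/andP; split; lra.
have aE : r * acos (y / r) / r = acos (y / r) by rewrite mulrAC divff ?mul1r ?gt_eqF.
exists (r * acos (y / r)); last first.
  rewrite /ordinate aE profile_sin; [|lra..].
  by rewrite sin_refl acosK ?in_itv// mulrC divfK ?gt_eqF.
rewrite /abscissa aE profile_sin// sin_acos//.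
have -> : 1 - (y / r) ^+ 2 = (x / r) ^+ 2.
  rewrite !expr_div_n; have -> : x ^+ 2 = r ^+ 2 - y ^+ 2 by rewrite -E addrK.
  by rewrite mulrBl divff// expf_neq0// gt_eqF.
by rewrite sqrtr_sqr ger0_norm ?divr_ge0 ?ltW// mulrC divfK ?gt_eqF.
Qed.

Lemma wrapK q : edge_surface q -> wrap (unwrap q) = q.
Proof. by move=> /wrap_surj[u <-]; rewrite unwrapK. Qed.

End RoundedEdge.

(** The order of [a] and [b] is left open, and the intermediate point is located by its distance to
    [a], the form in which the later estimates consume it. *)
Lemma mvt_between {R : realType} (f df : R -> R) (a b : R) :
    (forall t, `|t - a| <= `|b - a| -> is_derive t (1 : R) f (df t)) ->
  exists2 c, `|c - a| <= `|b - a| & f b - f a = df c * (b - a).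
Proof.
move=> fd; have [ab|ba|->] := ltgtP a b.
- have D t : t \in `[a, b] -> is_derive t (1 : R) f (df t).
    rewrite in_itv /= => /andP[? ?]; apply: fd.
    by rewrite !ger0_norm; lra.
  have [|c /[!in_itv]/= /andP[ac cb] E] := MVT ab (fun t tI => D t (subset_itv_oo_cc tI)).
    by apply: derivable_within_continuous => t /D[].
  by exists c => //; rewrite !ger0_norm; lra.
- have D t : t \in `[b, a] -> is_derive t (1 : R) f (df t).
    rewrite in_itv /= => /andP[? ?]; apply: fd.
    by rewrite !ler0_norm; lra.
  have [|c /[!in_itv]/= /andP[bc ca] E] := MVT ba (fun t tI => D t (subset_itv_oo_cc tI)).
    by apply: derivable_within_continuous => t /D[].
  exists c; first by rewrite !ler0_norm; lra.
  by rewrite -opprB E -mulrN opprB.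
- by exists b; rewrite ?subrr ?normr0// mulr0.
Qed.

Lemma cvg_rV {R : realType} {T : Type} {F : set_system T} `{FF : Filter T F} {n : nat}
    (f : T -> 'rV[R]_n) (l : 'rV[R]_n) :
  (forall i, f x 0 i @[x --> F] --> l 0 i) -> f x @[x --> F] --> l.
Proof.
move=> fl; apply/cvg_ballP => e e0; rewrite /ball /= /mx_ball.
have : \forall x \near F, forall j, ball (l 0 j) e (f x 0 j).
  by apply: filter_forall => j; move: (fl j) => /cvg_ballP; apply.
by apply: filterS => x h; split=> // i j; rewrite (ord1 i).
Qed.

(** * Chords of the surface compared with chords of the development *)

Section EdgeMetric.
Context {R : realType} (r : R).
Hypothesis r0 : 0 < r.
Implicit Types (s t : R) (u v : 'rV[R]_2) (p q : 'rV[R]_3).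
Local Notation X := (abscissa r).
Local Notation Y := (ordinate r).
Local Notation wrap := (wrap r).
Local Notation unwrap := (unwrap r).

Lemma is_derive_abscissa s : is_derive s 1 X (dprofile (s / r)).
Proof.
have d1 : is_derive s 1 (fun s => s / r) r^-1.
  have -> : (fun s => s / r) = (fun s => r^-1 *: s) by apply/funext => t; exact: mulrC.
  by apply: is_derive_eq; rewrite /GRing.scale /= mulr1.
have d2 : is_derive s 1 (fun s => profile (s / r)) (dprofile (s / r) * r^-1).
  exact: (is_derive1_comp (is_derive_profile _) d1).
have -> : dprofile (s / r) = r *: (dprofile (s / r) * r^-1).
  by rewrite /GRing.scale /= mulrCA divff ?gt_eqF// mulr1.
exact: is_deriveZ.
Qed.

Lemma is_derive_ordinate s : is_derive s 1 Y (- dprofile (pi / 2 - s / r)).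
Proof.
have -> : Y = X \o (fun s => r * (pi / 2) - s) by apply/funext => t; exact: ordinateE.
have d1 : is_derive s 1 (fun s => r * (pi / 2) - s) (-1).
  have := is_deriveB (is_derive_cst (r * (pi / 2)) s 1) (is_derive_id s 1).
  by rewrite sub0r.
have := is_derive1_comp (is_derive_abscissa _) d1.
by rewrite mulrN1 mulrBl mulrAC divff ?gt_eqF// mul1r.
Qed.

(** The mean value theorem fails for plane curves, but holds for each linear functional of them. The
    functional given by the chord yields the upper bound on chords, the one given by the tangent at
    [s] the lower bound. *)
Lemma profile_mvt (a b s t : R) : exists2 w, `|w - s| <= `|t - s| &
  a * (X t - X s) + b * (Y t - Y s) =
  (a * dprofile (w / r) - b * dprofile (pi / 2 - w / r)) * (t - s).
Proof.
have dF (w : R) : is_derive w (1 : R) (fun w => a * X w + b * Y w)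
    (a * dprofile (w / r) - b * dprofile (pi / 2 - w / r)).
  rewrite -mulrN; apply: is_deriveD; apply: is_deriveZ.
    exact: is_derive_abscissa.
  exact: is_derive_ordinate.
have [w ws E] := mvt_between (fun w (_ : `|w - s| <= `|t - s|) => dF w).
by exists w => //; rewrite -E; ring.
Qed.

Lemma dot_unit_le (a b c d : R) : c ^+ 2 + d ^+ 2 = 1 ->
  (a * c + b * d) ^+ 2 <= a ^+ 2 + b ^+ 2.
Proof.
move=> cd; rewrite -subr_ge0.
have -> : a ^+ 2 + b ^+ 2 = (a ^+ 2 + b ^+ 2) * (c ^+ 2 + d ^+ 2) by rewrite cd mulr1.
rewrite [leRHS](_ : _ = (a * d - b * c) ^+ 2) ?sqr_ge0//; ring.
Qed.

Lemma wrap_edist_sqr u v : edist (wrap u) (wrap v) ^+ 2 =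
  (X (u 0 0) - X (v 0 0)) ^+ 2 + (Y (u 0 0) - Y (v 0 0)) ^+ 2 +
  (u 0 1 - v 0 1) ^+ 2.
Proof. by rewrite sqr_enorm dotv3 !mxE /=. Qed.

Lemma edist2_sqr u v :
  edist u v ^+ 2 = (u 0 0 - v 0 0) ^+ 2 + (u 0 1 - v 0 1) ^+ 2.
Proof. by rewrite sqr_enorm dotv2 !mxE. Qed.

(** Testing the profile chord against itself gives |chord|^2 = (chord . tangent) (t - s) for a unit
    tangent; Cauchy-Schwarz then bounds the chord by |t - s|. *)
Lemma wrap_lip u v : edist (wrap u) (wrap v) <= edist u v.
Proof.
rewrite -(@ler_pXn2r _ 2)// ?nnegrE ?edist_ge0// wrap_edist_sqr edist2_sqr lerD2r.
move: (u 0 0) (v 0 0) => t s.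
set a := X t - X s; set b := Y t - Y s.
have [w _] := profile_mvt a b s t; rewrite -/a -/b -!expr2 => E.
have := dprofile_unit (w / r) => D.
have [->|ab0] := eqVneq (a ^+ 2 + b ^+ 2) 0; first exact: sqr_ge0.
have ab : 0 < a ^+ 2 + b ^+ 2 by rewrite lt_neqAle eq_sym ab0 addr_ge0 ?sqr_ge0.
rewrite -(ler_pM2l ab) -expr2 {1}E exprMn ler_wpM2r ?sqr_ge0//.
by rewrite -mulrN dot_unit_le// sqrrN.
Qed.

(** The profile chord is tested against the unit tangent at [s]. The tangents at [s] and at the
    intermediate point differ by an angle of at most e, whose cosine is at least 1 - e because cos
    is 1-Lipschitz. This crude bound suffices, since e will tend to 0. *)
Lemma wrap_expand u v (e : R) : 0 <= e -> e <= 1 -> `|u 0 0 - v 0 0| <= e * r ->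
  (1 - e) * edist u v <= edist (wrap u) (wrap v).
Proof.
move=> e0 e1 uve.
rewrite -(@ler_pXn2r _ 2)// ?nnegrE ?mulr_ge0 ?edist_ge0 ?subr_ge0//.
rewrite exprMn wrap_edist_sqr edist2_sqr mulrDr lerD//; last first.
  by rewrite ler_piMl ?sqr_ge0// expr_le1 ?subr_ge0//; lra.
move: (u 0 0) (v 0 0) uve => t s.
set a := X t - X s; set b := Y t - Y s => uve.
have [w ws] := profile_mvt (dprofile (s / r)) (- dprofile (pi / 2 - s / r)) s t.
rewrite -/a -/b => E.
have c1 : 1 - e <= dprofile (s / r) * dprofile (w / r)
   - - dprofile (pi / 2 - s / r) * dprofile (pi / 2 - w / r).
  rewrite !dprofile_refl /dprofile mulNr opprK -cosB.
  have := cos_lip (clamp (s / r) - clamp (w / r)) 0; rewrite cos0 subr0 => h.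
  have {}h := le_trans h (clamp_lip _ _).
  rewrite -mulrBl normrM (gtr0_norm (_ : 0 < r^-1)) ?invr_gt0// in h.
  have h2 : `|s - w| / r <= e.
    by rewrite ler_pdivrMr// (le_trans _ uve)// distrC.
  by move: (le_trans h h2); rewrite ler_norml => /andP[]; lra.
have := dprofile_unit (s / r) => D.
have {}E : (1 - e) ^+ 2 * (t - s) ^+ 2 <=
   (dprofile (s / r) * a + - dprofile (pi / 2 - s / r) * b) ^+ 2.
  rewrite E exprMn ler_wpM2r ?sqr_ge0// ler_pXn2r// ?nnegrE; [lra|].
  by apply: le_trans c1; lra.
apply: (le_trans E).
by rewrite ![_ * a]mulrC ![_ * b]mulrC dot_unit_le// sqrrN.
Qed.

Lemma continuous_unwrap : continuous unwrap.
Proof.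
move=> q; apply: (cvg_rV (F := nbhs q)) => i; rewrite /unwrap.
under eq_fun do rewrite mxE; rewrite mxE.
have cq j : continuous (fun p : 'rV[R]_3 => p 0 j) by exact: coord_continuous.
case: i => [[|[|//]]] ?; rewrite /=; last exact: cq.
have posc j : {for q, continuous (fun p : 'rV[R]_3 => pos (p 0 j))}.
  by apply: continuous_max; [exact: cq|exact: cst_continuous].
have minc j : {for q, continuous (fun p : 'rV[R]_3 => Num.min (p 0 j) 0)}.
  by apply: continuous_min; [exact: cq|exact: cst_continuous].
apply: cvgD; first exact: cvgB (minc _) (minc _).
apply: cvgMr; apply: continuous_cvg; first exact: continuous_atan.
apply: cvgM; first exact: posc.
apply: cvgV; first by rewrite gt_eqF// ltr_wpDr// pos_ge0.
by apply: cvgD; [exact: cvg_cst|exact: posc].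
Qed.

End EdgeMetric.

(** * Length and intrinsic distance read in the development *)

Section DevelopedLength.
Context {R : realType} (r : R).
Hypothesis r0 : 0 < r.
Implicit Types (s t : R) (u v : 'rV[R]_2) (p q : 'rV[R]_3) (c : R -> 'rV[R]_3).
Local Notation wrap := (wrap r).
Local Notation unwrap := (unwrap r).

(** A partition witnessing the bound is built by real induction on its right end: near each
    parameter one more chord is appended, [wrap_expand] bounds it from below, and the triangle
    inequality in the plane joins it to the previous ones. *)
Lemma approx_le_curve_length (a b e : R) c : 0 < e -> e < 1 -> a <= b ->
    {within `[a, b], continuous c} ->
    (forall t, a <= t <= b -> edge_surface r (c t)) ->
  (((1 - e) * edist (unwrap (c b)) (unwrap (c a)))%:E <= curve_length a b c)%E.
Proof.
move=> e0 e1 ab cc cS.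
suff [s abs sE] : exists2 s, itv_partition a b s &
    (1 - e) * edist (unwrap (c b)) (unwrap (c a)) <= polylength c a s.
  by apply: le_trans (polylength_le_curve_length c abs); rewrite lee_fin.
apply: (@real_induction _ a b (fun b => exists2 s, itv_partition a b s &
    (1 - e) * edist (unwrap (c b)) (unwrap (c a)) <= polylength c a s)) => //.
  by exists [::]; [split=> /=|rewrite edist_xx mulr0].
(* Two parameters near [t] have abscissas within e r / 2 of the one at [t], hence within e r of each
   other, as [wrap_expand] requires. *)
move=> t tab; have er0 : 0 < e * r / 2 by rewrite divr_gt0// mulr_gt0.
have : (fun x => unwrap (c x) 0 0) @ within `[a, b] (nbhs t) --> unwrap (c t) 0 0.
  apply: (@continuous_cvg _ _ _ (within `[a, b] (nbhs t)) _ c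
    (fun p => unwrap p 0 0)); last by move/subspace_continuousP: cc; apply.
  by apply: (@continuous_comp _ _ _ unwrap (fun u : 'rV[R]_2 => u 0 0));
    [exact: continuous_unwrap|exact: coord_continuous].
move=> /cvgrPdist_lt/(_ _ er0).
move=> /nbhs_ballP[d /= d0 tP]; exists d => // x y ax xy yb xt yt [s axs sE].
move: xy; rewrite le_eqVlt => /predU1P[<-|xy]; first by exists s.
exists (rcons s y); first exact: itv_partition_rcons axs xy.
rewrite polylength_rcons; have -> : last a s = x by case: axs => _ /eqP.
apply: le_trans (_ : (1 - e) * edist (unwrap (c y)) (unwrap (c x))
   + (1 - e) * edist (unwrap (c x)) (unwrap (c a)) <= _).
  rewrite -mulrDr ler_wpM2l ?subr_ge0 ?(ltW e1)//; exact: edist_triangle.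
rewrite addrC lerD//.
have cxy z : a <= z -> z <= b -> c z = wrap (unwrap (c z)).
  by move=> az zb; rewrite (wrapK r0)//; apply: cS; rewrite az.
have ay := le_trans ax (ltW xy); have xb := le_trans (ltW xy) yb.
rewrite [X in _ <= edist X _](cxy _ ay yb) [X in _ <= edist _ X](cxy _ ax xb).
apply: (wrap_expand r0); [exact: ltW|exact: ltW|].
have xh : `|unwrap (c t) 0 0 - unwrap (c x) 0 0| < e * r / 2.
  apply: tP; first by rewrite /ball /= distrC.
  by rewrite /= in_itv /= ax (le_trans (ltW xy) yb).
have yh : `|unwrap (c t) 0 0 - unwrap (c y) 0 0| < e * r / 2.
  apply: tP; first by rewrite /ball /= distrC.
  by rewrite /= in_itv /= yb (le_trans ax (ltW xy)).
move: xh yh; rewrite !ltr_norml ler_norml => /andP[? ?] /andP[? ?].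
by apply/andP; split; lra.
Qed.

Lemma developed_le_curve_length (a b : R) c : a <= b ->
    {within `[a, b], continuous c} ->
    (forall t, a <= t <= b -> edge_surface r (c t)) ->
  ((edist (unwrap (c b)) (unwrap (c a)))%:E <= curve_length a b c)%E.
Proof.
move=> ab cc cS; have L0 : (0 <= curve_length a b c)%E.
  by apply: le_trans (edist_le_curve_length c ab); rewrite lee_fin edist_ge0.
have := fun e e0 e1 => @approx_le_curve_length a b e c e0 e1 ab cc cS.
have := edist_ge0 (unwrap (c b)) (unwrap (c a)).
move: (edist (unwrap _) _) => D D0.
case: (curve_length a b c) L0 => [l||] //=; last by move=> _ _; exact: leey.
rewrite !lee_fin => l0 h; rewrite leNgt; apply/negP => lD.
have Dp : 0 < D by exact: le_lt_trans lD.
(* If the length l were below D, this value of e would make (1 - e) D the midpoint of l and D, which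
   exceeds l. *)
have := h ((D - l) / (2 * D)); rewrite lee_fin.
have -> : (1 - (D - l) / (2 * D)) * D = (D + l) / 2 by field; rewrite gt_eqF.
rewrite divr_gt0 ?subr_gt0 ?mulr_gt0// => /(_ isT).
rewrite ltr_pdivrMr ?mulr_gt0// mul1r.
have -> : D - l < 2 * D by lra.
by move=> /(_ isT); lra.
Qed.

Lemma continuous_wrap : continuous wrap.
Proof.
move=> u; apply: (cvg_rV (F := nbhs u)) => i; rewrite /wrap.
under eq_fun do rewrite mxE; rewrite mxE.
have cq j : continuous (fun p : 'rV[R]_2 => p 0 j) by exact: coord_continuous.
case: i => [[|[|[|//]]]] ?; rewrite /=; last exact: cq.
  apply: continuous_comp; first exact: cq.
  apply: differentiable_continuous; apply/derivable1_diffP.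
  by have [] := is_derive_abscissa r0 (u 0 0).
apply: continuous_comp; first exact: cq.
apply: differentiable_continuous; apply/derivable1_diffP.
by have [] := is_derive_ordinate r0 (u 0 0).
Qed.

Definition line u v (t : R) : 'rV[R]_2 := u + t *: (v - u).

Lemma edist_line u v s t : edist (line u v t) (line u v s) = `|t - s| * edist u v.
Proof.
rewrite [edist u v]edistC -enormZ /line /edist.
by rewrite opprD addrACA subrr add0r -scalerBl.
Qed.

Lemma continuous_line u v : continuous (line u v).
Proof.
move=> t; apply: cvgD; first exact: cvg_cst.
by apply: cvgZr_tmp; exact: cvg_id.
Qed.

Lemma joins_line u v : joins (edge_surface r) 0 1 (wrap \o line u v) (wrap u) (wrap v).
Proof.
split=> //=.
- apply: continuous_subspaceT => t; apply: continuous_comp; first exact: continuous_line.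
  exact: continuous_wrap.
- by move=> t _; exact: wrap_surface.
- by rewrite /line scale0r addr0.
- by rewrite /line scale1r addrC subrK.
Qed.

Lemma curve_length_line u v :
  (curve_length 0 1 (wrap \o line u v) <= (edist u v)%:E)%E.
Proof.
have := @lipschitz_curve_length _ (wrap \o line u v) (edist u v) 0 1.
rewrite subr0 mulr1; apply=> // [|x y x0 xy y1]; first exact: edist_ge0.
apply: le_trans (wrap_lip r0 _ _) _.
by rewrite edist_line mulrC ger0_norm ?subr_ge0.
Qed.

(** [wrap] is defined on the whole plane, so the image of the straight segment is always an
    admissible competitor, and the isometry is global rather than local. *)
Lemma intrinsic_dist_edge u v :
  intrinsic_dist (edge_surface r) (wrap u) (wrap v) = (edist u v)%:E.
Proof.
apply/eqP; rewrite eq_le; apply/andP; split.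
  apply: le_trans (curve_length_line u v); apply: ereal_inf_lbound.
  by exists 0, 1, (wrap \o line u v); split=> //; exact: joins_line.
apply: le_ereal_inf_tmp => _ [a [b [c [[ab cc cS ca cb] ->]]]].
by rewrite edistC -(unwrapK r0 u) -(unwrapK r0 v) -ca -cb developed_le_curve_length.
Qed.

End DevelopedLength.

(** * Completeness, convexity and regularity *)

Section SupNorm.
Context {R : realType} {n : nat}.
Implicit Types u v : 'rV[R]_n.

Lemma normr_coord_le u i : `|u 0 i| <= `|u|.
Proof. by rewrite [leRHS]/Num.Def.normr /= mx_normrE; exact: (le_bigmax _ _ (0, i)). Qed.

Lemma normr_le_coord u (a : R) : 0 <= a -> (forall i, `|u 0 i| <= a) -> `|u| <= a.
Proof.
move=> a0 ua; rewrite [leLHS]/Num.Def.normr /= mx_normrE.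
by apply: bigmax_le => // -[i j] _; rewrite (ord1 i).
Qed.

Lemma normr_le_enorm u : `|u| <= enorm u.
Proof.
apply: normr_le_coord => [|i]; first exact: enorm_ge0.
rewrite -(@ler_pXn2r _ 2)// ?nnegrE ?enorm_ge0// sqr_enorm real_normK ?num_real//.
rewrite /dotv (bigD1 i)//= -expr2 lerDl; apply: sumr_ge0 => j _.
by rewrite -expr2 sqr_ge0.
Qed.

Lemma enorm_le_normr u : enorm u <= n%:R * `|u|.
Proof.
rewrite -(@ler_pXn2r _ 2)// ?nnegrE ?enorm_ge0 ?mulr_ge0// sqr_enorm exprMn.
apply: (@le_trans _ _ (\sum_(i < n) `|u| ^+ 2)).
  apply: ler_sum => i _; rewrite -expr2 -(real_normK (num_real (u 0 i))).
  by rewrite ler_pXn2r ?nnegrE// normr_coord_le.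
rewrite sumr_const card_ord -[_ *+ n]mulr_natl ler_wpM2r ?sqr_ge0//.
by rewrite -natrX ler_nat; case: n => // k; rewrite expnS leq_pmulr// expn1.
Qed.

End SupNorm.

Section EdgeSurface.
Context {R : realType} (r : R).
Hypothesis r0 : 0 < r.
Implicit Types (s t : R) (u v : 'rV[R]_2) (p q : 'rV[R]_3).
Local Notation wrap := (wrap r).
Local Notation unwrap := (unwrap r).
Local Notation S := (edge_surface r).

(** The surface is intrinsically a Euclidean plane. Completeness of the plane is available for the
    sup norm, hence the two norm comparisons. *)
Lemma edge_complete : complete_surface S.
Proof.
move=> x xS xC; pose u k := unwrap (x k).
have xE k : x k = wrap (u k) by rewrite (wrapK r0).
have uC : cauchy (u @ \oo).
  apply: cauchy_exP => e e0; have [N NP] := xC _ e0.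
  exists (u N); exists N => // k /= Nk; rewrite -ball_normE /=.
  apply: le_lt_trans (normr_le_enorm _) _.
  by have := NP _ _ (leqnn N) Nk; rewrite !xE intrinsic_dist_edge// lte_fin.
have /cauchy_cvgP/cvg_ex[/= l ul] := uC.
exists (wrap l); first exact: wrap_surface.
rewrite (_ : (fun _ => _) = (fun k => (edist (u k) l)%:E)); last first.
  by apply/funext => k; rewrite xE intrinsic_dist_edge.
apply: cvg_EFin; first exact: nearW.
apply/cvgrPdist_le => e e0; have e20 : 0 < e / 2 by rewrite divr_gt0.
move/cvgrPdist_le : ul => /(_ _ e20); apply: filterS => k lk.
rewrite /= sub0r normrN ger0_norm ?edist_ge0// edistC.
apply: le_trans (enorm_le_normr _) _.
by rewrite mulrC -ler_pdivlMr.
Qed.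

Definition edge_body : set 'rV[R]_3 :=
  [set q | pos (q 0 0) ^+ 2 + pos (q 0 1) ^+ 2 <= r ^+ 2].

Lemma continuous_edge_function :
  continuous (fun q : 'rV[R]_3 => pos (q 0 0) ^+ 2 + pos (q 0 1) ^+ 2).
Proof.
move=> q.
have cq j : continuous (fun p : 'rV[R]_3 => p 0 j) by exact: coord_continuous.
have posc j : {for q, continuous (fun p : 'rV[R]_3 => pos (p 0 j))}.
  by apply: continuous_max; [exact: cq|exact: cst_continuous].
exact: cvgD (cvgM (posc 0) (posc 0)) (cvgM (posc 1) (posc 1)).
Qed.

Lemma pos_convex (a b l : R) : 0 <= l -> l <= 1 ->
  pos (l * a + (1 - l) * b) <= l * pos a + (1 - l) * pos b.
Proof.
move=> l0 l1; have m0 : 0 <= 1 - l by rewrite subr_ge0.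
rewrite {1}/pos ge_max addr_ge0 ?mulr_ge0 ?pos_ge0// andbT.
by rewrite lerD// ler_wpM2l// /pos le_max lexx.
Qed.

Lemma sqr_convex (a b l : R) : 0 <= l -> l <= 1 ->
  (l * a + (1 - l) * b) ^+ 2 <= l * a ^+ 2 + (1 - l) * b ^+ 2.
Proof.
move=> l0 l1; rewrite -subr_ge0.
rewrite [leRHS](_ : _ = l * (1 - l) * (a - b) ^+ 2); last by ring.
by rewrite mulr_ge0 ?sqr_ge0// mulr_ge0// subr_ge0.
Qed.

Lemma edge_body_convex : convex_set (edge_body : set (convex_lmodType 'rV[R]_3)).
Proof.
move=> p q l; rewrite !inE => pB qB.
have -> : conv l p q = (l%:num *: p + (1 - l%:num) *: q : 'rV[R]_3) by [].
have l0 : 0 <= l%:num :> R by [].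
have l1 : l%:num <= 1 :> R by [].
have coord (i : 'I_3) : pos ((l%:num *: p + (1 - l%:num) *: q : 'rV[R]_3) 0 i) ^+ 2
    <= l%:num * pos (p 0 i) ^+ 2 + (1 - l%:num) * pos (q 0 i) ^+ 2.
  rewrite !mxE; apply: le_trans (sqr_convex _ _ l0 l1).
  rewrite ler_pXn2r ?nnegrE ?pos_ge0 ?pos_convex//.
  by rewrite addr_ge0 ?mulr_ge0 ?pos_ge0// subr_ge0.
rewrite /edge_body /=; apply: le_trans (lerD (coord _) (coord _)) _.
have lpB := ler_wpM2l l0 pB; have m0 : 0 <= 1 - l%:num :> R by rewrite subr_ge0.
have lqB := ler_wpM2l m0 qB.
by rewrite /= in lpB lqB; lra.
Qed.

Lemma edge_body_closed : closed edge_body.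
Proof.
rewrite (_ : edge_body =
    (fun q => pos (q 0 0) ^+ 2 + pos (q 0 1) ^+ 2) @^-1` [set x | x <= r ^+ 2])//.
by apply: closed_comp; [move=> q _; exact: continuous_edge_function|exact: closed_le].
Qed.

(** The defining function is homogeneous of degree 2 under positive dilations, so a dilation of
    ratio slightly above 1 takes any point of the level r^2 out of the body. *)
Lemma edge_body_interior :
  interior edge_body = [set q | pos (q 0 0) ^+ 2 + pos (q 0 1) ^+ 2 < r ^+ 2].
Proof.
apply/seteqP; split=> q; last first.
  have : open [set q : 'rV[R]_3 | pos (q 0 0) ^+ 2 + pos (q 0 1) ^+ 2 < r ^+ 2].
    apply: (@open_comp _ _ (fun q : 'rV[R]_3 => pos (q 0 0) ^+ 2 + pos (q 0 1) ^+ 2)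
      [set x | x < r ^+ 2]); last exact: open_lt.
    by move=> p _; exact: continuous_edge_function.
  rewrite openE => h /h; apply: filterS => p /=; exact: ltW.
move=> qB; have := interior_subset qB; rewrite /edge_body /= le_eqVlt.
case/predU1P=> // qE.
have fq : q + t *: q @[t --> (0 : R)] --> q.
  rewrite -[X in _ --> X]addr0 -(scale0r q); apply: cvgD; first exact: cvg_cst.
  by apply: cvgZr_tmp; exact: cvg_id.
have /nbhs_ballP[d /= d0 dB] := fq _ qB.
have d20 : 0 < d / 2 by rewrite divr_gt0.
have : edge_body (q + (d / 2) *: q).
  by apply: dB; rewrite /ball /= sub0r normrN gtr0_norm//; lra.
have m0 : 0 <= 1 + d / 2 by lra.
rewrite /edge_body /= -{1 3}(scale1r q) -!scalerDl !mxE !posM// !exprMn -mulrDr qE.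
rewrite -subr_ge0.
rewrite (_ : _ - _ = - (d + (d / 2) ^+ 2) * r ^+ 2); last by field.
rewrite pmulr_lge0 ?exprn_gt0// oppr_ge0 leNgt => /negP[].
by rewrite addr_gt0// exprn_gt0.
Qed.

Lemma edge_convex : convex_surface S.
Proof.
exists edge_body; split.
  split; [exact: edge_body_convex|exact: edge_body_closed|].
  exists 0; rewrite edge_body_interior /= !mxE /pos maxxx expr0n addr0.
  by rewrite exprn_gt0.
rewrite edge_body_interior; have /closure_id <- := edge_body_closed.
apply/seteqP; split=> q /=.
  by move=> qE; rewrite /edge_body /= qE lexx ltxx.
by case; rewrite /edge_body /= => qB /negP; rewrite -leNgt => qB'; apply/eqP; rewrite eq_le qB.
Qed.

End EdgeSurface.

Lemma lipschitz_continuous {R : realType} (V W : normedModType R) (f : V -> W) (k : R) :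
  0 < k -> (forall u v, `|f u - f v| <= k * `|u - v|) -> continuous f.
Proof.
move=> k0 fk u; apply/cvgrPdist_le => e e0.
have ek0 : 0 < e / k by rewrite divr_gt0.
have /cvgrPdist_le/(_ _ ek0) := @cvg_id _ (nbhs u).
apply: filterS => v uv; apply: le_trans (fk _ _) _.
by rewrite mulrC -ler_pdivlMr.
Qed.

Lemma is_derive_coord {R : realType} n (f : R -> R) (j : 'I_n) (u v : 'rV[R]_n) (d : R) :
  is_derive (u 0 j) (v 0 j) f d -> is_derive u v (fun w => f (w 0 j)) d.
Proof.
have E : (fun h : R => h^-1 *: (((fun w : 'rV[R]_n => f (w 0 j)) \o shift u) (h *: v)
      - f (u 0 j))) =
    (fun h : R => h^-1 *: ((f \o shift (u 0 j)) (h *: v 0 j) - f (u 0 j))).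
  by apply/funext => h; rewrite /= !mxE.
case=> fd fE; split; first by rewrite /derivable E.
by rewrite /derive E -fE.
Qed.

Lemma is_derive_rV {R : realType} (V : normedModType R) n (f : V -> 'rV[R]_n)
    (u v : V) (d : 'rV[R]_n) :
  (forall j, is_derive u v (fun w => f w 0 j) (d 0 j)) -> is_derive u v f d.
Proof.
move=> fd; have df : derivable f u v.
  by apply/derivable_mxP => i j; rewrite (ord1 i); case: (fd j).
split=> //; rewrite derive_mx//; apply/rowP => j; rewrite mxE.
by case: (fd j).
Qed.

Section EdgeRegularity.
Context {R : realType} (r : R).
Hypothesis r0 : 0 < r.
Implicit Types (s t : R) (u v : 'rV[R]_2) (p q : 'rV[R]_3).
Local Notation wrap := (wrap r).
Local Notation unwrap := (unwrap r).
Local Notation S := (edge_surface r).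

Definition edge_frame (i : 'I_2) u : 'rV[R]_3 :=
  if i == 0 then rv3 (dprofile (u 0 0 / r)) (- dprofile (pi / 2 - u 0 0 / r)) 0
  else rv3 0 0 1.

Lemma is_derive_wrap i u : is_derive u (delta_mx 0 i) wrap (edge_frame i u).
Proof.
apply: is_derive_rV => j; rewrite /edge_frame /wrap.
under [X in is_derive _ _ X _]eq_fun do rewrite mxE.
have i01 : i = 0 \/ i = 1.
  by case: i => [[|[|//]]] ?; [left|right]; apply: val_inj.
case: j => [[|[|[|//]]]] ? /=.
- apply: is_derive_coord; rewrite mxE eqxx /=.
  case: i01 => ->; rewrite /= mxE /=; first exact: is_derive_abscissa.
  exact: is_derive0.
- apply: is_derive_coord; rewrite mxE eqxx /=.
  case: i01 => ->; rewrite /= mxE /=; first exact: is_derive_ordinate.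
  exact: is_derive0.
- apply: (is_derive_coord (f := id)); rewrite mxE eqxx /=.
  by case: i01 => ->; rewrite /= mxE /=; exact: is_derive_id.
Qed.

Lemma partial_wrap i : partial i wrap = edge_frame i.
Proof. by apply/funext => u; rewrite /partial; case: (is_derive_wrap i u). Qed.

Lemma edge_frame_lip i u v : `|edge_frame i u - edge_frame i v| <= r^-1 * `|u - v|.
Proof.
have k0 : 0 <= r^-1 by rewrite invr_ge0 ltW.
rewrite /edge_frame; case: ifP => _; last by rewrite subrr normr0 mulr_ge0.
have bound : `|u 0 0 / r - v 0 0 / r| <= r^-1 * `|u - v|.
  rewrite -mulrBl normrM (ger0_norm k0) mulrC ler_wpM2l//.
  by have := normr_coord_le (u - v) 0; rewrite !mxE.
apply: normr_le_coord => [|j]; first by rewrite mulr_ge0.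
rewrite !mxE; case: j => [[|[|[|//]]]] ? /=.
- exact: le_trans (dprofile_lip _ _) bound.
- rewrite -opprD normrN; apply: le_trans (dprofile_lip _ _) _.
  by rewrite opprB addrC subrKA distrC.
- by rewrite subrr normr0 mulr_ge0.
Qed.

Lemma edge_frame_dot i j u : dotv (edge_frame i u) (edge_frame j u) = (i == j)%:R.
Proof.
rewrite dotv3 /edge_frame.
have := dprofile_unit (u 0 0 / r) => D.
case: i => [[|[|//]]] ?; case: j => [[|[|//]]] ?; rewrite /= !mxE /=.
- by rewrite mul0r addr0 mulrNN -!expr2.
- by rewrite !(mulr0, mul0r, mulr1) !addr0.
- by rewrite !(mulr0, mul0r, mulr1) !addr0.
- by rewrite !(mulr0, mul0r, mulr1) !add0r.
Qed.

(** The single chart [wrap] covers the surface. The Lipschitz constant r^-1 is the curvature of the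
    arc. *)
Lemma edge_C11 : C11_surface S.
Proof.
move=> p pS; exists setT, setT, wrap.
have cpart i : continuous (partial i wrap).
  rewrite partial_wrap; apply: (@lipschitz_continuous _ _ _ _ r^-1).
    by rewrite invr_gt0.
  exact: edge_frame_lip.
split=> //.
- split; [exact: openT|exact: openT| | |].
  + apply/seteqP; split=> q /=.
      by move=> [u _ <-]; split=> //; exact: wrap_surface.
    by move=> [qS _]; exists (unwrap q) => //; exact: wrapK.
  + exists unwrap; split; last by move=> u _; exact: unwrapK.
    by apply: continuous_subspaceT; exact: continuous_unwrap.
  (* The frame is orthonormal, so its transpose is a right inverse. *)
  + move=> u _; apply/row_freeP; exists (tangent_frame wrap u)^T.
    apply/matrixP => i j; rewrite !mxE -[RHS]/((i == j)%:R).
    rewrite -(edge_frame_dot i j u); apply: eq_bigr => k _.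
    by rewrite !mxE !partial_wrap.
- split=> i.
    split; last exact: continuous_subspaceT.
    by move=> u _; have [] := is_derive_wrap i u.
  apply: (@klipschitzW _ _ _ r^-1).
    exact: (@globally_properfilter _ _ (0, 0)).
  by move=> [u v] /= _; rewrite partial_wrap; exact: edge_frame_lip.
Qed.

End EdgeRegularity.

(** * Parallel surfaces *)

Section ParallelEdges.
Context {R : realType} (a b : R).
Hypotheses (a0 : 0 < a) (ab : a < b).
Implicit Types (p q : 'rV[R]_3).

(** The vector to [p] from its foot, the nearest point of the wedge x, y <= 0. On [edge_surface r]
    it is an outward normal of length r. *)
Definition edge_normal p : 'rV[R]_3 := rv3 (pos (p 0 0)) (pos (p 0 1)) 0.

Lemma edge_normal_sqr (r : R) p : edge_surface r p ->
  dotv (edge_normal p) (edge_normal p) = r ^+ 2.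
Proof. by rewrite /edge_surface /= => <-; rewrite dotv3 !mxE /= mulr0 addr0 -!expr2. Qed.

Definition push p : 'rV[R]_3 := p + ((b - a) / a) *: edge_normal p.

Lemma push_surface p : edge_surface a p -> edge_surface b (push p).
Proof.
have ba0 : 0 <= (b - a) / a by rewrite divr_ge0 ?subr_ge0 ?ltW.
have bE : 1 + (b - a) / a = b / a.
  by rewrite mulrBl divff ?gt_eqF// addrC subrK.
have posD (x : R) : pos (x + (b - a) / a * pos x) = b / a * pos x.
  have [x0|x0] := leP x 0; first by rewrite (pos_eq0 x0) mulr0 addr0 pos_eq0// mulr0.
  rewrite (pos_id (ltW x0)) -[X in X + _]mul1r -mulrDl bE pos_id//.
  by rewrite mulr_ge0 ?divr_ge0// ltW// (lt_trans a0).
rewrite /edge_surface /= !mxE /= !posD !exprMn -mulrDr => ->.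
by rewrite exprVn divfK// expf_neq0// gt_eqF.
Qed.

(** The foot p - [edge_normal p] lies in the wedge, and points of [edge_surface b] are at distance
    at least b from the wedge. *)
Lemma edge_foot_dist p q : edge_surface b q ->
  b ^+ 2 <= dotv (q - (p - edge_normal p)) (q - (p - edge_normal p)).
Proof.
have aux (x y : R) : pos y ^+ 2 <= (y - (x - pos x)) ^+ 2.
  have [y0|y0] := leP y 0; first by rewrite pos_eq0// expr0n sqr_ge0.
  have xx : x - pos x <= 0 by rewrite subr_le0 /pos le_max lexx.
  by rewrite (pos_id (ltW y0)) ler_pXn2r// ?nnegrE ?(ltW y0)//; lra.
rewrite /edge_surface /= => <-; rewrite dotv3 !mxE /= -!expr2.
by rewrite -[leLHS]addr0 !lerD ?aux// sqr_ge0.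
Qed.

Lemma push_dist p : edge_surface a p -> edist p (push p) = b - a.
Proof.
move=> pS; rewrite edistC /edist /push addrC addKr -[Num.sqrt _]/(enorm _).
rewrite enormZ /enorm (edge_normal_sqr pS) sqrtr_sqr !gtr0_norm//.
  by rewrite divfK// gt_eqF.
by rewrite divr_gt0// subr_gt0.
Qed.

(** Triangle inequality through the foot of [p], which is at distance a from [p] and at least b from
    [q]. *)
Lemma edge_dist_ge p q : edge_surface a p -> edge_surface b q -> b - a <= edist p q.
Proof.
move=> pS qS; set N := edge_normal p; pose m := q - (p - N).
have b0 : 0 < b := lt_trans a0 ab.
have Na : enorm N = a by rewrite /enorm (edge_normal_sqr pS) sqrtr_sqr gtr0_norm.
have mb : b <= enorm m.
  by rewrite -(@ler_pXn2r _ 2)// ?nnegrE ?enorm_ge0 ?(ltW b0)// sqr_enorm edge_foot_dist.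
have := enormD (m - N) N; rewrite subrK Na.
rewrite edistC /edist -[Num.sqrt _]/(enorm _).
have -> : m - N = q - p by rewrite /m opprB addrA addrAC addrK.
by lra.
Qed.

(** Equality case of that triangle inequality. With m the vector from the foot to [q] and N the
    normal at [p], the hypothesis makes |m - (b / a) N|^2 at most (1 - b / a) (|m|^2 - b^2), which
    is nonpositive as a < b <= |m|; hence [q] lies on the normal ray. *)
Lemma edge_dist_eq p q : edge_surface a p -> edge_surface b q ->
  edist p q <= b - a -> q = push p.
Proof.
move=> pS qS; have [N NE] : exists N, N = edge_normal p by eexists.
have [m m_def] : exists m, m = q - (p - N) by eexists.
have b0 : 0 < b := lt_trans a0 ab.
have NN : dotv N N = a ^+ 2 by rewrite NE; exact: edge_normal_sqr.
have mm : b ^+ 2 <= dotv m m by rewrite m_def NE; exact: edge_foot_dist.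
rewrite edistC -(@ler_pXn2r _ 2)// ?nnegrE ?edist_ge0 ?subr_ge0 ?(ltW ab)//.
rewrite -[edist _ _]/(enorm _) sqr_enorm.
have -> : q - p = m - N by rewrite m_def opprB addrA addrAC addrK.
rewrite dotvBl !dotvBr (dotvC N m) NN => h.
have E : dotv (m - (b / a) *: N) (m - (b / a) *: N) <= 0.
  rewrite dotvBl !dotvBr !dotvZl !dotvZr (dotvC N m) NN.
  have ba : 0 < b / a by rewrite divr_gt0.
  have : b / a * (dotv m m - b ^+ 2 + 2 * (a * b)) <= b / a * (2 * dotv m N).
    by rewrite ler_wpM2l ?(ltW ba)//; lra.
  have -> : b / a * (dotv m m - b ^+ 2 + 2 * (a * b)) =
    b / a * (dotv m m - b ^+ 2) + 2 * b ^+ 2 by field; rewrite gt_eqF.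
  have -> : b / a * (b / a * a ^+ 2) = b ^+ 2 by field; rewrite gt_eqF.
  have : 1 * (dotv m m - b ^+ 2) <= b / a * (dotv m m - b ^+ 2).
    by rewrite ler_wpM2r ?subr_ge0// ler_pdivlMr// mul1r ltW.
  by lra.
have /dotvv_eq0/eqP : dotv (m - (b / a) *: N) (m - (b / a) *: N) = 0.
  by apply/eqP; rewrite eq_le E dotvv_ge0.
rewrite subr_eq0 => /eqP mE; rewrite /push mulrBl divff ?gt_eqF// scalerBl scale1r.
by rewrite -NE -mE m_def opprB addrAC subrKA addrC subrK.
Qed.

Lemma nearest_push p : edge_surface a p -> nearest (edge_surface b) p = [set push p].
Proof.
move=> pS; apply/seteqP; split=> q /=.
  by move=> [qS /(_ _ (push_surface pS))]; rewrite push_dist// => /(edge_dist_eq pS qS).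
move=> ->; split; first exact: push_surface.
by move=> z zS; rewrite push_dist// edge_dist_ge.
Qed.

Lemma projection_push p : edge_surface a p -> projection (edge_surface b) p = push p.
Proof. by move=> pS; rewrite /projection nearest_push//; exact: get_unique. Qed.

Lemma edge_constant_distance :
  regular_constant_distance (b - a) (edge_surface a) (edge_surface b).
Proof.
split=> [|p pS]; first by rewrite subr_gt0.
split; last by exists (push p); rewrite nearest_push//; split=> // q ->.
apply/eqP; rewrite eq_le; apply/andP; split.
  apply: ge_inf; last by exists (push p); [exact: push_surface|exact: push_dist].
  by exists (b - a) => _ [q qS <-]; exact: edge_dist_ge.
apply: lb_le_inf; first by exists (edist p (push p)), (push p) => //; exact: push_surface.
by move=> _ [q qS <-]; exact: edge_dist_ge.
Qed.

End ParallelEdges.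

(** * Principal curvatures *)

Section PlaneCalculus.
Context {R : realType}.

Lemma is_derive_line (V W : normedModType R) (F : V -> W) (u v : V) (t : R) (d : W) :
  is_derive (u + t *: v) v F d -> is_derive t (1 : R) (fun t => F (u + t *: v)) d.
Proof.
have E : (fun h : R => h^-1 *: (((fun t => F (u + t *: v)) \o shift t) (h *: (1 : R))
      - F (u + t *: v)))
   = (fun h : R => h^-1 *: ((F \o shift (u + t *: v)) (h *: v) - F (u + t *: v))).
  apply/funext => h /=; congr (_ *: (F _ - _)).
  by rewrite scalerDl addrCA [X in X *: v]mulr1.
case=> fd fE; split; first by rewrite /derivable E.
by rewrite /derive E -fE.
Qed.

Lemma rv2_line (t y : R) : rv2 t y = rv2 0 y + t *: delta_mx 0 0.
Proof.
by apply/rowP => i; rewrite !mxE; case: i => [[|[|//]]] ? /=;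
  rewrite ?mulr1 ?add0r ?mulr0 ?addr0.
Qed.

Lemma rv2_column (t y : R) : rv2 y t = rv2 y 0 + t *: delta_mx 0 1.
Proof.
by apply/rowP => i; rewrite !mxE; case: i => [[|[|//]]] ? /=;
  rewrite ?mulr1 ?add0r ?mulr0 ?addr0.
Qed.

Lemma is_derive_row (F : 'rV[R]_2 -> R) (t y d : R) :
  is_derive (rv2 t y) (delta_mx 0 0) F d -> is_derive t (1 : R) (fun t => F (rv2 t y)) d.
Proof.
under [X in _ -> is_derive _ _ X _]eq_fun do rewrite rv2_line.
by rewrite rv2_line; exact: is_derive_line.
Qed.

Lemma is_derive_col (F : 'rV[R]_2 -> R) (t y d : R) :
  is_derive (rv2 y t) (delta_mx 0 1) F d -> is_derive t (1 : R) (fun t => F (rv2 y t)) d.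
Proof.
under [X in _ -> is_derive _ _ X _]eq_fun do rewrite rv2_column.
by rewrite rv2_column; exact: is_derive_line.
Qed.

(* If [F] vanishes at points accumulating at [u], its differential there kills
   a limit direction. *)
Lemma det_jacobian_eq0 (F : 'I_2 -> 'rV[R]_2 -> R) (G : 'I_2 -> 'I_2 -> 'rV[R]_2 -> R)
    (u : 'rV[R]_2) :
    (forall i j, \forall w \near u, is_derive w (delta_mx 0 i) (F j) (G i j w)) ->
    (forall i j, G i j w @[w --> u] --> G i j u) ->
    (forall d : R, 0 < d -> exists v, [/\ v != u, `|v - u| < d & forall j, F j v = F j u]) ->
  G 0 0 u * G 1 1 u - G 0 1 u * G 1 0 u = 0.
Proof.
move=> FG Gc Fv; set D := _ - _; apply/eqP; rewrite -normr_le0; apply/ler_addgt0Pr => e e0.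
rewrite add0r.
(* M dominates the coefficients used in Cramer's rule below; with this [eta] the final error 2 eta M
   is e / 2. *)
pose M := 1 + `|G 0 0 u| + `|G 0 1 u| + `|G 1 0 u| + `|G 1 1 u|.
have M1 : 1 <= M by rewrite /M -!addrA lerDl !addr_ge0.
have M0 : 0 < M by exact: lt_le_trans M1.
pose eta := e / (4 * M); have eta0 : 0 < eta by rewrite divr_gt0// mulr_gt0.
have FGij i j : \forall w \near u, is_derive w (delta_mx 0 i) (F j) (G i j w) /\
    `|G i j u - G i j w| <= eta.
  by have /cvgrPdist_le/(_ _ eta0) := Gc i j; apply: filterS2 (FG i j) => w.
have : \forall w \near u, forall i j, is_derive w (delta_mx 0 i) (F j) (G i j w) /\
    `|G i j u - G i j w| <= eta.
  exact: (filter_forall _ (fun i => filter_forall _ (FGij i))).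
move=> /nbhs_ballP[d /= d0 dP].
have [v [vu vd vF]] := Fv _ d0.
(* Balls of the sup norm are squares, so the axis-parallel path from u through (u_0, v_1) to v stays
   inside. *)
have box (x y : R) : `|x - u 0 0| <= `|v - u| -> `|y - u 0 1| <= `|v - u| ->
    ball u d (rv2 x y).
  move=> xu yu; rewrite -ball_normE /=; apply: le_lt_trans vd.
  rewrite distrC; apply: normr_le_coord => // i.
  rewrite !mxE; case: i => [[|[|//]]] hi /=.
    by rewrite (_ : Ordinal hi = 0)//; exact: val_inj.
  by rewrite (_ : Ordinal hi = 1)//; exact: val_inj.
have v0 : `|v 0 0 - u 0 0| <= `|v - u| by have := normr_coord_le (v - u) 0; rewrite !mxE.
have v1 : `|v 0 1 - u 0 1| <= `|v - u| by have := normr_coord_le (v - u) 1; rewrite !mxE.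
(* The increments of [F j] along the two sides of the path cancel; replacing the partial derivatives
   at the intermediate points by those at u costs eta per side. *)
have step j : `|(v 0 0 - u 0 0) * G 0 j u + (v 0 1 - u 0 1) * G 1 j u| <= 2 * eta * `|v - u|.
  have [x xv Ex] := @mvt_between _ (fun x => F j (rv2 x (v 0 1))) (fun x => G 0 j (rv2 x (v 0 1)))
    (u 0 0) (v 0 0) (fun t tu => is_derive_row (dP _ (box _ _ (le_trans tu v0) v1) 0 j).1).
  have u10 : `|u 0 0 - u 0 0| <= `|v - u| by rewrite subrr normr0.
  have [y yv Ey] := @mvt_between _ (fun y => F j (rv2 (u 0 0) y)) (fun y => G 1 j (rv2 (u 0 0) y))
    (u 0 1) (v 0 1) (fun t tu => is_derive_col (dP _ (box _ _ u10 (le_trans tu v1)) 1 j).1).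
  have [_ Gx] := dP _ (box _ _ (le_trans xv v0) v1) 0 j.
  have [_ Gy] := dP _ (box _ _ u10 (le_trans yv v1)) 1 j.
  rewrite !rv2K vF in Ex Ey.
  rewrite (_ : _ + _ = (v 0 0 - u 0 0) * (G 0 j u - G 0 j (rv2 x (v 0 1)))
     + (v 0 1 - u 0 1) * (G 1 j u - G 1 j (rv2 (u 0 0) y))); last first.
    rewrite !mulrBr.
    by rewrite ![(v 0 _ - u 0 _) * G _ j (rv2 _ _)]mulrC -Ex -Ey; ring.
  apply: le_trans (ler_normD _ _) _; rewrite !normrM mulrAC mulr2n mulrDl mul1r mulrDl lerD//.
    by rewrite ler_pM.
  by rewrite ler_pM.
have n0 : 0 < `|v - u| by rewrite normr_gt0 subr_eq0.
have eE : 2 * eta * M <= e.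
  by rewrite /eta invfM mulrA mulrA mulfVK ?gt_eqF//; lra.
suff : `|D *: (v - u)| <= 2 * eta * `|v - u| * M.
  rewrite normrZ mulrAC ler_pM2r// => h; exact: le_trans eE.
(* Cramer's rule: each coordinate of D (v - u) is such a combination of the two nearly vanishing
   expressions. *)
have comb (g h : R) : `|g| + `|h| <= M -> forall j k,
  `|((v 0 0 - u 0 0) * G 0 j u + (v 0 1 - u 0 1) * G 1 j u) * g
   - ((v 0 0 - u 0 0) * G 0 k u + (v 0 1 - u 0 1) * G 1 k u) * h| <= 2 * eta * `|v - u| * M.
  move=> ghM j k; apply: le_trans (ler_normB _ _) _; rewrite !normrM.
  apply: le_trans (lerD (ler_wpM2r _ (step j)) (ler_wpM2r _ (step k))) _ => //.
  by rewrite -mulrDr ler_wpM2l// mulr_ge0// mulr_ge0// ltW.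
have G0 i j : 0 <= `|G i j u| by [].
apply: normr_le_coord => [|i].
  by rewrite mulr_ge0 ?(ltW M0)// mulr_ge0// mulr_ge0// ltW.
rewrite !mxE.
case: i => [[|[|//]]] hi.
  rewrite (_ : Ordinal hi = 0); last exact: val_inj.
  have gh : `|G 1 1 u| + `|G 1 0 u| <= M.
    by have := G0 0 0; have := G0 0 1; rewrite /M; lra.
  by have := comb _ _ gh 0 1; congr (`|_| <= _); rewrite /D; ring.
rewrite (_ : Ordinal hi = 1); last exact: val_inj.
have gh : `|G 0 0 u| + `|G 0 1 u| <= M.
  by have := G0 1 0; have := G0 1 1; rewrite /M; lra.
by have := comb _ _ gh 1 0; congr (`|_| <= _); rewrite /D; ring.
Qed.

End PlaneCalculus.

Section FlatCurvature.
Context {R : realType} (r : R).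
Hypothesis r0 : 0 < r.
Implicit Types (s t : R) (u v : 'rV[R]_2) (p q : 'rV[R]_3).
Local Notation S := (edge_surface r).

Lemma is_derive_dotv (V : normedModType R) (f : V -> 'rV[R]_3) (u v : V) (nu : 'rV[R]_3) :
  derivable f u v -> is_derive u v (fun w => dotv (f w) nu) (dotv ('D_v f u) nu).
Proof.
move=> df; have /derivable_mxP df' := df.
have dfj j : is_derive u v (fun w => f w 0 j * nu 0 j) ('D_v f u 0 j * nu 0 j).
  rewrite derive_mx// mxE ![_ * nu 0 j]mulrC.
  under eq_fun do rewrite mulrC.
  by apply: is_deriveZ; apply/derivableP; exact: df'.
rewrite (_ : (fun w => _) = fun w => f w 0 0 * nu 0 0 + f w 0 1 * nu 0 1 + f w 0 2%:R * nu 0 2%:R).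
  by rewrite dotv3; apply: is_deriveD.
by apply/funext => w; rewrite dotv3.
Qed.

Lemma continuous_dotv (nu : 'rV[R]_3) : continuous (fun p => dotv p nu).
Proof.
rewrite (_ : (fun p => _) = fun p => p 0 0 * nu 0 0 + p 0 1 * nu 0 1 + p 0 2%:R * nu 0 2%:R).
  have cq j : continuous (fun p : 'rV[R]_3 => p 0 j) by exact: coord_continuous.
  move=> p; have cj j : (fun p : 'rV[R]_3 => p 0 j * nu 0 j) @ nbhs p --> p 0 j * nu 0 j.
    exact: cvgM (cq j p) (cvg_cst _).
  exact: cvgD (cvgD (cj _) (cj _)) (cj _).
by apply/funext => p; rewrite dotv3.
Qed.

(** [T] has rank 2, so the kernel of its transpose is a line. *)
Lemma normal_unique (T : 'M[R]_(2, 3)) (n nu : 'rV[R]_3) : row_free T -> n != 0 ->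
  n *m T^T = 0 -> nu *m T^T = 0 -> exists c, nu = c *: n.
Proof.
move=> fT n0 /sub_kermxP nK /sub_kermxP nuK.
have [_] := mxrank_leqif_sup nK.
rewrite rank_rV n0 mxrank_ker mxrank_tr (eqP fT) eqxx => /esym Kn.
exact/sub_rVP/(submx_trans nuK).
Qed.

(** Replacing the coordinates of [q] by their positive parts can only increase the product with the
    nonnegative normal; then 2xy <= x^2 + y^2 applies. *)
Lemma edge_normal_le p q : S p -> S q -> dotv q (edge_normal p) <= r ^+ 2.
Proof.
rewrite /edge_surface /= => pS qS; rewrite dotv3 !mxE /= mulr0 addr0.
have aux (x y : R) : 2 * (x * pos y) <= pos x ^+ 2 + pos y ^+ 2.
  have h : x * pos y <= pos x * pos y by rewrite ler_wpM2r ?pos_ge0// /pos le_max lexx.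
  by have := sqr_ge0 (pos x - pos y); lra.
by have := aux (q 0 0) (p 0 0); have := aux (q 0 1) (p 0 1); lra.
Qed.

Lemma edge_normal_eq q : S q -> dotv q (edge_normal q) = r ^+ 2.
Proof.
rewrite /edge_surface /= => <-; rewrite dotv3 !mxE /= mulr0 addr0.
have aux (x : R) : x * pos x = pos x ^+ 2.
  by have [x0|x0] := leP x 0; rewrite ?(pos_eq0 x0) ?(pos_id (ltW x0)) ?mulr0 ?expr0n.
by rewrite !aux.
Qed.

Lemma edge_normal_neq0 p : S p -> edge_normal p != 0.
Proof.
move=> pS; apply/eqP => n0; have := edge_normal_sqr pS.
rewrite n0 dotv3 !mxE !mulr0 !addr0 => /esym/eqP.
by rewrite sqrf_eq0 gt_eqF.
Qed.

(* [S] lies in the half-space [dotv q n <= r ^ 2], so a tangent vector at a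
   boundary point of it is orthogonal to [n]. *)
Lemma tangent_orth (V : set 'rV[R]_2) phi u i : open V -> V u ->
    (forall w, V w -> S (phi w)) ->
    (forall w, V w -> derivable phi w (delta_mx 0 i)) ->
  dotv (partial i phi u) (edge_normal (phi u)) = 0.
Proof.
move=> oV Vu VS dphi; set n := edge_normal _.
have /nbhs_ballP[d /= d0 dV] : nbhs u V by exact: open_nbhs_nbhs.
have e0 : 0 < d / (1 + `|delta_mx 0 i : 'rV[R]_2|) by rewrite divr_gt0// ltr_pwDl.
set e := d / _ in e0.
have inV t : t \in `]-e, e[ -> V (u + t *: delta_mx 0 i).
  rewrite in_itv /= -ltr_norml => te; apply: dV; rewrite -ball_normE /= opprD addNKr normrN normrZ.
  apply: le_lt_trans (_ : `|t| * (1 + `|delta_mx 0 i : 'rV[R]_2|) < d).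
    by rewrite ler_wpM2l// lerDr.
  by rewrite -ltr_pdivlMr// ltr_pwDl.
pose f t := dotv (phi (u + t *: delta_mx 0 i)) n.
have df t : t \in `]-e, e[ ->
    is_derive t (1 : R) f (dotv (partial i phi (u + t *: delta_mx 0 i)) n).
  move=> te; apply: (@is_derive_line _ _ _ (fun w => dotv (phi w) n)).
  by apply: is_derive_dotv; apply: dphi; exact: inV.
have z : 0 \in `]-e, e[ by rewrite in_itv /= oppr_lt0 e0.
have fmax t : t \in `]-e, e[ -> f t <= f 0.
  move=> te; have uS : S (phi u) by exact: VS.
  rewrite {2}/f scale0r addr0 edge_normal_eq//; apply: edge_normal_le => //.
  by apply: VS; exact: inV.
have ee : - e <= e by rewrite ge0_cp// ltW.
have [_ D0] := derive1_at_max ee (fun t te => @ex_derive _ _ _ _ _ _ _ (df t te)) z fmax.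
by have [_] := df 0 z; rewrite D0 scale0r addr0.
Qed.

Lemma det2_eq0 (A : 'M[R]_2) : A 0 0 * A 1 1 - A 0 1 * A 1 0 = 0 -> \det A = 0.
Proof.
move=> <-; rewrite (expand_det_row _ 0) !big_ord_recl big_ord0 addr0.
rewrite /cofactor !det_mx11 !mxE /= expr0 expr1 mul1r mulN1r mulrN.
by congr (A _ _ * A _ _ - A _ _ * A _ _); exact: val_inj.
Qed.

(* Moving along the ruling through [phi u] leaves the normal [n] unchanged, so
   the functions [dotv (partial j phi _) n] vanish along a whole curve. *)
Lemma edge_second_form_degenerate (U : set 'rV[R]_3) (V : set 'rV[R]_2) phi u :
    local_param S U V phi -> C2_on V phi -> V u ->
  dotv (partial 0 (partial 0 phi) u) (edge_normal (phi u)) *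
    dotv (partial 1 (partial 1 phi) u) (edge_normal (phi u)) -
  dotv (partial 0 (partial 1 phi) u) (edge_normal (phi u)) *
    dotv (partial 1 (partial 0 phi) u) (edge_normal (phi u)) = 0.
Proof.
move=> [oU oV img [psi [cpsi psiK]] _] [C1 C2] Vu.
have imgV w : V w -> (S `&` U) (phi w) by move=> Vw; rewrite -img; exists w.
have VS w : V w -> S (phi w) by move=> /imgV[].
have [pS pU] := imgV _ Vu.
set n := edge_normal _.
have orth w i : V w -> edge_normal (phi w) = n -> dotv (partial i phi w) n = 0.
  by move=> Vw <-; apply: (tangent_orth oV) => // w'; exact: (C1 i).1.
(* With the normal frozen at its value at [phi u], the Jacobian of these two functions at [u] is the
   second fundamental form up to a scalar. *)
apply: (@det_jacobian_eq0 _ (fun j w => dotv (partial j phi w) n)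
   (fun i j w => dotv (partial i (partial j phi) w) n)).
- move=> i j; have : nbhs u V by exact: open_nbhs_nbhs.
  by apply: filterS => w Vw; apply: is_derive_dotv; exact: (C2 j i).1.
- move=> i j; have := (C2 j i).2; rewrite continuous_open_subspace// => /(_ u).
  rewrite inE => /(_ Vu) c.
  exact: (continuous_comp (g := fun p : 'rV[R]_3 => dotv p n) c (@continuous_dotv n _)).
- move=> d d0; move/subspace_continuousP: cpsi => /(_ (phi u) (imgV _ Vu)).
  move=> /cvgrPdist_lt/(_ _ d0)/nbhs_ballP[e /= e0 eP].
  have /nbhs_ballP[e' /= e'0 e'P] : nbhs (phi u) U by exact: open_nbhs_nbhs.
  have [t [t0 te te']] : exists t : R, [/\ 0 < t, t < e & t < e'].
    by have [ee'|e'e] := leP e e'; [exists (e / 2)|exists (e' / 2)]; split; lra.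
  (* The chart is arbitrary, so the ruling is pulled back through [psi]: t < e' keeps [q] in the
     range of the chart, and t < e puts its parameter within [d] of [u]. *)
  pose q := phi u + rv3 0 0 t.
  have qp a : t < a -> ball (phi u) a q.
    move=> ta; rewrite -ball_normE /= opprD addNKr normrN.
    apply: le_lt_trans ta; apply: normr_le_coord => [|i]; first exact: ltW.
    by rewrite mxE; case: i => [[|[|[|//]]]] ? /=; rewrite ?normr0 ?gtr0_norm// ltW.
  have qn : edge_normal q = n by rewrite /edge_normal !mxE /= !addr0.
  have qSU : (S `&` U) q.
    split; last by apply: e'P; exact: qp.
    by rewrite /edge_surface /= !mxE /= !addr0.
  have [v Vv vq] : (phi @` V) q by rewrite img.
  exists v; split.
  + apply/eqP => vu; move: vq; rewrite vu => /rowP/(_ 2%:R); rewrite !mxE /=.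
    by move=> /eqP; rewrite eq_sym -subr_eq0 addrAC subrr add0r gt_eqF.
  + have : `|psi (phi u) - psi q| < d := eP q (qp _ te) qSU.
    by rewrite -vq !psiK// distrC.
  + by move=> j; rewrite !orth// vq.
Qed.

(** The product is the constant coefficient of the characteristic polynomial, that is the
    determinant of the shape operator. Since [nu] is a multiple of [edge_normal], the determinant of
    the second form is a multiple of the degenerate one above. *)
Lemma edge_curvature p (a1 a2 : R) : principal_curvatures S p a1 a2 -> a1 * a2 = 0.
Proof.
move=> [U [V [phi [u [nu [lp C2 [Vu phiu] [nunu nuT] charE]]]]]].
have pS : S (phi u).
  case: lp => _ _ img _ _; have : (S `&` U) (phi u) by rewrite -img; exists u.
  by case.
have nT i : dotv (partial i phi u) (edge_normal (phi u)) = 0.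
  case: lp => _ oV img _ _; apply: (tangent_orth oV) => // w Vw.
    by have : (S `&` U) (phi w) by [rewrite -img; exists w]; case.
  by case: C2 => C1 _; exact: (C1 i).1.
have mulT (m : 'rV[R]_3) : (forall i, dotv (partial i phi u) m = 0) ->
    m *m (tangent_frame phi u)^T = 0.
  move=> mT; apply/rowP => i; rewrite !mxE -[RHS](mT i) dotvC.
  by apply: eq_bigr => k _; rewrite !mxE.
have [c nuE] : exists c, nu = c *: edge_normal (phi u).
  apply: normal_unique (mulT _ nT) (mulT _ nuT); last exact: edge_normal_neq0.
  by case: lp => _ _ _ _; exact.
have dS : \det (second_form phi nu u) = 0.
  have sE i j : second_form phi nu u i j =
      c * dotv (partial i (partial j phi) u) (edge_normal (phi u)).
    by rewrite /second_form mxE nuE; exact: dotvZr.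
  apply: det2_eq0; rewrite (sE 0 0) (sE 0 1) (sE 1 0) (sE 1 1).
  have scale (x y z w : R) : x * y - z * w = 0 -> c * x * (c * y) - c * z * (c * w) = 0.
    by move=> xy; rewrite mulrACA [X in _ - X]mulrACA -mulrBr xy mulr0.
  exact: scale (edge_second_form_degenerate lp C2 Vu).
have := char_poly_det (shape_operator phi nu u).
rewrite charE det_mulmx dS !mulr0 -horner_coef0 hornerM !hornerXsubC.
by rewrite !sub0r mulrNN.
Qed.

End FlatCurvature.

(** * Geodesics *)

Section EdgeGeodesics.
Context {R : realType} (r : R).
Hypothesis r0 : 0 < r.
Implicit Types (s t x y z : R) (u v : 'rV[R]_2) (p q : 'rV[R]_3).
Local Notation wrap := (wrap r).
Local Notation unwrap := (unwrap r).
Local Notation S := (edge_surface r).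

Lemma proper_setT : proper_interval [set: R].
Proof. by split=> //; exists 0, 1. Qed.

Lemma unit_speed_line u v : edist u v = 1 ->
  unit_speed_geodesic S setT (wrap \o line u v).
Proof.
move=> uv1.
have len s t : s <= t -> curve_length s t (wrap \o line u v) = (t - s)%:E.
  move=> st; apply/eqP; rewrite eq_le; apply/andP; split.
    rewrite -[t - s]mul1r; apply: lipschitz_curve_length => // x y _ xy _.
    apply: le_trans (wrap_lip r0 _ _) _.
    by rewrite edist_line uv1 mulr1 mul1r ger0_norm ?subr_ge0.
  apply: le_trans (developed_le_curve_length r0 st _ _).
  - by rewrite /= !(unwrapK r0) edist_line uv1 mulr1 ger0_norm ?subr_ge0.
  - apply: continuous_subspaceT => x; apply: continuous_comp.
      exact: continuous_line.
    exact: continuous_wrap.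
  - by move=> x _; exact: wrap_surface.
split.
- exact: proper_setT.
- by move=> t _; exact: wrap_surface.
- by move=> s t _ _; exact: len.
(* Lines of the development minimize globally, so any radius would do. *)
- move=> t0 _; exists 1 => // s t _ _ st _ _ a b c [ab cc cS ca cb].
  rewrite len//; apply: le_trans (developed_le_curve_length r0 ab cc cS).
  by rewrite ca cb /= !(unwrapK r0) edist_line uv1 mulr1 ger0_norm ?subr_ge0.
Qed.

Lemma geodesic_unit_speed (S' : set 'rV[R]_3) J c :
  unit_speed_geodesic S' J c -> geodesic S' J c.
Proof.
move=> us; split; first by case: us.
exists J, c, id; split=> //.
- by move=> t _; split; rewrite ?derive_id ?oner_eq0.
- apply: continuous_subspaceT => t.
  rewrite (_ : 'D_(1 : R) id = cst (1 : R)); first exact: cst_continuous.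
  by apply/funext => x; rewrite derive_id.
- by rewrite image_id.
Qed.

Lemma unit_speed_developed_le J c x y : unit_speed_geodesic S J c ->
  J x -> J y -> x <= y -> edist (unwrap (c y)) (unwrap (c x)) <= y - x.
Proof.
move=> [[Jitv _] cS cl _] Jx Jy xy; rewrite -lee_fin -(cl _ _ Jx Jy xy).
have inJ t : x <= t <= y -> J t by move=> /andP[xt ty]; apply: (Jitv x y) => //; rewrite xt.
(* Continuity is not part of [unit_speed_geodesic]; it follows because a chord is no longer than the
   arc, so [c] is 1-Lipschitz. *)
apply: developed_le_curve_length => // [|t /inJ/cS//].
apply/subspace_continuousP => t /=; rewrite in_itv /= => tI.
apply/cvgrPdist_le => e e0; rewrite near_withinE.
apply/nbhs_ballP; exists e => // t' /= tt'; rewrite in_itv /= => t'I.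
apply: le_trans (normr_le_enorm _) _; apply: le_trans (ltW tt').
wlog : t t' tI t'I {tt'} / t <= t'.
  move=> h; have [tt|/ltW tt] := leP t t'; first exact: h.
  by rewrite -[enorm _]/(edist _ _) edistC distrC; exact: h.
move=> tt; rewrite distrC ger0_norm ?subr_ge0// -lee_fin -cl//; [|exact: inJ..].
by rewrite -[enorm _]/(edist _ _) edistC; exact: edist_le_curve_length.
Qed.

(* In the developed plane a locally minimizing curve cannot have a corner. *)
Lemma unit_speed_developed_eq J c (t0 e : R) : unit_speed_geodesic S J c ->
    (forall s t, J s -> J t -> s <= t -> `|s - t0| < e -> `|t - t0| < e ->
      forall a b c', joins S a b c' (c s) (c t) ->
      (curve_length s t c <= curve_length a b c')%E) ->
    forall x z y, J x -> J z -> J y -> x <= z -> z <= y ->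
    `|x - t0| < e -> `|y - t0| < e ->
  edist (unwrap (c y)) (unwrap (c z)) + edist (unwrap (c z)) (unwrap (c x)) <=
  edist (unwrap (c y)) (unwrap (c x)).
Proof.
move=> us cmin x z y Jx Jz Jy xz zy xe ye.
have xy := le_trans xz zy.
(* y - x is the length of the arc: it dominates the sum of the two developed chords, and by
   minimality it is at most the length of the wrapped segment between the ends. *)
apply: (@le_trans _ _ (y - x)).
  have := unit_speed_developed_le us Jz Jy zy.
  by have := unit_speed_developed_le us Jx Jz xz; lra.
case: (us) => _ cS cl _; rewrite -lee_fin -(cl _ _ Jx Jy xy).
have := joins_line r0 (unwrap (c x)) (unwrap (c y)).
rewrite !(wrapK r0); [|exact: cS..] => j.
apply: le_trans (cmin _ _ Jx Jy xy xe ye _ _ _ j) _.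
by rewrite edistC; exact: curve_length_line.
Qed.

End EdgeGeodesics.

(** * The projection in the development and the broken image of an oblique line *)

Section PushDeveloped.
Context {R : realType} (a b : R).
Hypotheses (a0 : 0 < a) (ab : a < b).
Implicit Types (s z : R).

Lemma push_wrap_flat s z : s <= 0 -> push a b (wrap a (rv2 s z)) = wrap b (rv2 s z).
Proof.
have b0 := lt_trans a0 ab.
move=> s0; rewrite /push /edge_normal /wrap !mxE /= !abscissa_le0//.
have ord (r : R) : 0 < r -> ordinate r s = r.
  by move=> r0; rewrite ordinateE// abscissa_ge//; lra.
rewrite !ord// (pos_eq0 s0) (pos_id (ltW a0)).
apply/rowP => i; rewrite !mxE; case: i => [[|[|[|//]]]] ? /=.
- by rewrite mulr0 addr0.
- by rewrite divfK ?gt_eqF// addrC subrK.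
- by rewrite mulr0 addr0.
Qed.

Lemma push_wrap_arc s z : 0 <= s -> s <= a * (pi / 2) ->
  push a b (wrap a (rv2 s z)) = wrap b (rv2 (b / a * s) z).
Proof.
have b0 := lt_trans a0 ab.
move=> s0 s1.
have t0 : 0 <= s / a by rewrite divr_ge0 // ltW.
have t1 : s / a <= pi / 2 by rewrite ler_pdivrMr// mulrC.
have sn : 0 <= sin (s / a).
  by rewrite -cos_refl cos_ge0_pihalf//; apply/andP; split; lra.
have cs : 0 <= cos (s / a).
  by rewrite cos_ge0_pihalf//; apply/andP; split; lra.
have abE : b / a * s / b = s / a by field; rewrite !gt_eqF.
rewrite /push /edge_normal /wrap !mxE /= /abscissa /ordinate abE.
rewrite !profile_sin; [|lra..]; rewrite sin_refl !pos_id ?mulr_ge0 ?(ltW a0)//.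
apply/rowP => i; rewrite !mxE; case: i => [[|[|[|//]]]] ? /=.
- by field; rewrite gt_eqF.
- by field; rewrite gt_eqF.
- by rewrite mulr0 addr0.
Qed.

End PushDeveloped.

Section NotPreserving.
Context {R : realType}.
(** A rational unit vector oblique to the junction s = 0, which the line crosses at parameter 0. *)
Let dir : 'rV[R]_2 := rv2 (3 / 5) (4 / 5).

Definition crossing_geodesic : R -> 'rV[R]_3 := wrap 1 \o line 0 dir.

Lemma crossing_geodesicE (t : R) :
  crossing_geodesic t = wrap 1 (rv2 (3 / 5 * t) (4 / 5 * t)).
Proof.
rewrite /crossing_geodesic /=; congr wrap; rewrite /line subr0 add0r.
by apply/rowP => i; rewrite !mxE; case: i => [[|[|//]]] ? /=; rewrite mulrC.
Qed.

Lemma geodesic_crossing : geodesic (edge_surface 1) setT crossing_geodesic.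
Proof.
apply: geodesic_unit_speed; apply: unit_speed_line; first exact: ltr01.
apply/eqP; rewrite -(@eqrXn2 _ 2) ?edist_ge0// edist2_sqr !mxE /= expr1n.
by apply/eqP; field.
Qed.

(** The exact values are |AO| = t, |OB| = (sqrt 52 / 5) t and |AB| = (sqrt 145 / 5) t. The rational
    bounds 1.44 t and 2.42 t on the last two already separate the sides, as 2.42 < 1 + 1.44. *)
Lemma corner (t : R) (A O B : 'rV[R]_2) : 0 < t ->
    A = rv2 (- (3 / 5 * t)) (- (4 / 5 * t)) -> O = rv2 0 0 ->
    B = rv2 (6 / 5 * t) (4 / 5 * t) ->
  edist A B < edist A O + edist O B.
Proof.
move=> t0 -> -> ->.
set P := rv2 _ _; set Q := rv2 0 0; set Z := rv2 _ _.
have PO : t <= edist P Q.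
  rewrite -(@ler_pXn2r _ 2)// ?nnegrE ?edist_ge0 ?(ltW t0)// edist2_sqr !mxE /=.
  by have := sqr_ge0 t; lra.
have OB : 36 / 25 * t <= edist Q Z.
  rewrite -(@ler_pXn2r _ 2)// ?nnegrE ?edist_ge0 ?mulr_ge0 ?(ltW t0)//.
  by rewrite edist2_sqr !mxE /=; have := sqr_ge0 t; lra.
have AB : edist P Z <= 242 / 100 * t.
  rewrite -(@ler_pXn2r _ 2)// ?nnegrE ?edist_ge0 ?mulr_ge0 ?(ltW t0)//.
  by rewrite edist2_sqr !mxE /=; have := sqr_ge0 t; lra.
lra.
Qed.

(** Let [K] send the parameter of the line to that of the supposed unit speed geodesic [c]. Being
    continuous and injective, [K] is strictly monotone, so K 0 lies between K (- t) and K t; for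
    small t minimality of [c] forces equality in a triangle inequality which [corner] shows to be
    strict. *)
Lemma crossing_not_preserved :
  ~ preserves_geodesics (edge_surface 1) (edge_surface 2)
      (projection (edge_surface (2 : R))).
Proof.
move=> /(_ _ _ geodesic_crossing).
move=> [J [sigma [h [[_ [J2 [c [k [us dk _ imk sE]]]]] hc _ imh FE]]]].
have ltr12 : (1 : R) < 2 by rewrite ltr1n.
have ltr02 : (0 : R) < 2 by [].
pose K := k \o h.
have Jh t : J (h t) by rewrite -imh; exists t.
have J2K t : J2 (K t) by rewrite -imk; exists (h t).
pose g t := unwrap 2 (c (K t)).
have cK t : c (K t) = push 1 2 (crossing_geodesic t).
  rewrite /K /= -sE// -FE//= (projection_push ltr01 ltr12)//.
  by rewrite crossing_geodesicE; exact: wrap_surface.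
have gneg t : t <= 0 -> g t = rv2 (3 / 5 * t) (4 / 5 * t).
  move=> t0; rewrite /g cK crossing_geodesicE push_wrap_flat ?unwrapK//.
  by rewrite mulr_ge0_le0.
(* For t <= 1 the abscissa 3 / 5 t is below pi / 2, so the point is still on the arc, where the
   projection doubles the abscissa. *)
have gpos t : 0 <= t -> t <= 1 -> g t = rv2 (6 / 5 * t) (4 / 5 * t).
  move=> t0 t1; rewrite /g cK crossing_geodesicE push_wrap_arc ?unwrapK//.
  - by congr rv2; field.
  - by rewrite mulr_ge0.
  - by have := pihalf_ge1 R; lra.
have Kc : continuous K.
  move=> t; apply: continuous_comp.
    by move: hc; rewrite continuous_open_subspace; [apply; rewrite in_setT|exact: openT].
  by apply: differentiable_continuous; apply/derivable1_diffP; exact: (dk _ (Jh t)).1.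
(* The projection keeps the third coordinate, which is strictly increasing along the line. *)
have Kinj : injective K.
  move=> s t st; have := cK s; rewrite st cK !crossing_geodesicE => /rowP/(_ 2%:R).
  rewrite !mxE /= mulr0 !addr0 => h45.
  exact: (@mulfI _ (4 / 5)).
have [_ _ _ /(_ _ (J2K 0))[e e0 cmin]] := us.
have := Kc 0 => /cvgrPdist_lt/(_ _ e0)/nbhs_ballP[d /= d0 dP].
have [t [t0 t1 td]] : exists t : R, [/\ 0 < t, t <= 1 & t < d].
  by have [d1|d1] := leP d 1; [exists (d / 2)|exists (1 / 2)]; split; lra.
have Kp : `|K t - K 0| < e.
  by rewrite distrC; apply: dP; rewrite /ball /= sub0r normrN gtr0_norm.
have Kn : `|K (- t) - K 0| < e.
  by rewrite distrC; apply: dP; rewrite /ball /= sub0r opprK gtr0_norm.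
have corn := @corner t (g (- t)) (g 0) (g t) t0.
have {}corn : edist (g (- t)) (g t) < edist (g (- t)) (g 0) + edist (g 0) (g t).
  apply: corn.
  - by rewrite gneg ?oppr_le0 ?(ltW t0)// !mulrN.
  - by rewrite gneg// !mulr0.
  - by rewrite gpos// ltW.
have nt0 : - t < 0 by rewrite oppr_lt0.
(* The reparametrization may reverse orientation, so both monotonicities have to be refuted. *)
have [] := @itv_continuous_inj_mono _ K `]-oo, +oo[.
- by apply: continuous_subspaceT.
- by move=> x y _ _; exact: Kinj.
- move=> mono.
  have h1 : K (- t) < K 0 by apply: mono; rewrite ?in_itv.
  have h2 : K 0 < K t by apply: mono; rewrite ?in_itv.
  have : edist (g t) (g 0) + edist (g 0) (g (- t)) <= edist (g t) (g (- t)).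
    have := unit_speed_developed_eq ltr02 us cmin
      (J2K _) (J2K _) (J2K _) (ltW h1) (ltW h2) Kn Kp.
    by [].
  rewrite [edist (g t) (g 0)]edistC [edist (g 0) (g (- t))]edistC.
  by rewrite [edist (g t) (g (- t))]edistC; lra.
- move=> mono.
  have h1 : K 0 < K (- t) by apply: mono; rewrite ?in_itv.
  have h2 : K t < K 0 by apply: mono; rewrite ?in_itv.
  have : edist (g (- t)) (g 0) + edist (g 0) (g t) <= edist (g (- t)) (g t).
    have := unit_speed_developed_eq ltr02 us cmin
      (J2K _) (J2K _) (J2K _) (ltW h2) (ltW h1) Kp Kn.
    by [].
  by lra.
Qed.

End NotPreserving.

Theorem theorem1p4 (R : realType) :
  exists (r : R) (K0 Kr : set 'rV[R]_3),
    [/\ regular_constant_distance r K0 Kr,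
        [/\ complete_surface K0, convex_surface K0 & C11_surface K0],
        [/\ complete_surface Kr, convex_surface Kr & C11_surface Kr],
        (forall K : set 'rV[R]_3, K = K0 \/ K = Kr ->
           forall p, C2_surface_at K p ->
           forall a1 a2, principal_curvatures K p a1 a2 ->
             a1 * a2 = 0 \/ a1 = a2)
      & ~ preserves_geodesics K0 Kr (projection Kr)].
Proof.
have ltr12 : (1 : R) < 2 by rewrite ltr1n.
have ltr02 : (0 : R) < 2 by [].
exists (2 - 1), (edge_surface 1), (edge_surface 2); split.
- exact: edge_constant_distance ltr01 ltr12.
- by split; [exact: edge_complete|exact: edge_convex|exact: edge_C11].
- by split; [exact: edge_complete|exact: edge_convex|exact: edge_C11].
- by move=> K [] -> p _ a1 a2 /edge_curvature h; left; exact: h.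
- exact: crossing_not_preserved.
Qed.
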